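(* The triangulated category $\mathcal{P}(\mathbb{Z}/4)$ of finitely generated projective $\mathbb{Z}/4$-modules, with the identity functor as translation functor, is not exact equivalent to a full triangulated subcategory of the homotopy category $\operatorname{Ho}\mathcal{M}$ of any stable model category $\mathcal{M}$.
   Context: A triangulated category is an additive category with a translation self-equivalence $\Sigma$ and a collection of exact triangles satisfying Puppe's axioms and Verdier's octahedral axiom. The category $\mathcal{P}(\mathbb{Z}/4)$ has exactly one triangulated category structure with translation functor $\Sigma=\mathrm{id}$, and this is the structure meant in the claim. An exact functor between triangulated categories is an additive functor which commutes with the translation functors up to natural isomorphism and preserves exact triangles; an exact equivalence is an exact functor that is an equivalence of categories. A stable model category is a pointed Quillen model category $\mathcal{M}$ whose suspension functor is a self-equivalence of $\operatorname{Ho}\mathcal{M}$; its homotopy category $\operatorname{Ho}\mathcal{M}$ is triangulated in the usual way, with translation functor the suspension and exact triangles the diagrams isomorphic to cofiber sequences. *)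

(* Defs.v *)
From HB Require Import structures.
From mathcomp Require Import all_boot all_algebra.
From mathcomp Require Import boolp.

Set Implicit Arguments.
Unset Strict Implicit.
Unset Printing Implicit Defensive.

Import GRing.Theory.

Declare Scope cat_scope.
Delimit Scope cat_scope with cat.
Local Open Scope cat_scope.

Record category := Category {
  ob :> Type;
  hom : ob -> ob -> Type;
  cid : forall X, hom X X;
  ccomp : forall X Y Z, hom Y Z -> hom X Y -> hom X Z;
  ccompA : forall X Y Z W (h : hom Z W) (g : hom Y Z) (f : hom X Y),
    ccomp h (ccomp g f) = ccomp (ccomp h g) f;
  ccomp1l : forall X Y (f : hom X Y), ccomp (cid Y) f = f;
  ccomp1r : forall X Y (f : hom X Y), ccomp f (cid X) = f }.

Arguments hom {c} X Y.
Arguments cid {c} X.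
Arguments ccomp {c X Y Z} g f.

Notation "g ∘ f" := (ccomp g f) (at level 40, left associativity) : cat_scope.

Definition is_iso (C : category) (X Y : C) (f : hom X Y) : Prop :=
  exists g : hom Y X, g ∘ f = cid X /\ f ∘ g = cid Y.

Definition is_initial (C : category) (X : C) : Prop :=
  forall Y : C, exists f : hom X Y, forall g, g = f.

Definition is_terminal (C : category) (X : C) : Prop :=
  forall Y : C, exists f : hom Y X, forall g, g = f.

Definition is_zero (C : category) (X : C) : Prop :=
  is_initial X /\ is_terminal X.

Definition is_zero_map (C : category) (X Y : C) (f : hom X Y) : Prop :=
  exists (Z : C) (a : hom X Z) (b : hom Z Y), is_zero Z /\ f = b ∘ a.

Definition pointed (C : category) : Prop := exists Z : C, is_zero Z.

Record functor (C D : category) := Functor {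
  fob :> C -> D;
  fmap : forall X Y : C, hom X Y -> hom (fob X) (fob Y);
  fmap1 : forall X, fmap (cid X) = cid (fob X);
  fmapM : forall X Y Z (g : hom Y Z) (f : hom X Y),
    fmap (g ∘ f) = fmap g ∘ fmap f }.

Arguments fmap {C D} _ {X Y} _.

Definition functor_id (C : category) : functor C C :=
  @Functor C C (fun X => X) (fun _ _ f => f) (fun _ => erefl)
    (fun _ _ _ _ _ => erefl).

Program Definition functor_comp (C D E : category)
    (G : functor D E) (F : functor C D) : functor C E :=
  @Functor C E (fun X => G (F X)) (fun X Y f => fmap G (fmap F f)) _ _.
Next Obligation. by rewrite !fmap1. Qed.
Next Obligation. by rewrite !fmapM. Qed.

Record nat_trans (C D : category) (F G : functor C D) := NatTrans {
  nt_at :> forall X : C, hom (F X) (G X);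
  nt_natural : forall (X Y : C) (f : hom X Y),
    nt_at Y ∘ fmap F f = fmap G f ∘ nt_at X }.

Definition is_nat_iso (C D : category) (F G : functor C D)
    (t : nat_trans F G) : Prop :=
  forall X : C, is_iso (t X).

Definition is_equivalence (C D : category) (F : functor C D) : Prop :=
  exists (G : functor D C)
         (a : nat_trans (functor_comp G F) (functor_id C))
         (b : nat_trans (functor_comp F G) (functor_id D)),
    is_nat_iso a /\ is_nat_iso b.

Record preadditive (C : category) := Preadditive {
  hzero : forall X Y : C, hom X Y;
  hopp : forall X Y : C, hom X Y -> hom X Y;
  hadd : forall X Y : C, hom X Y -> hom X Y -> hom X Y;
  haddA : forall (X Y : C) (f g h : hom X Y),
    hadd f (hadd g h) = hadd (hadd f g) h;
  haddC : forall (X Y : C) (f g : hom X Y), hadd f g = hadd g f;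
  hadd0 : forall (X Y : C) (f : hom X Y), hadd (hzero X Y) f = f;
  haddN : forall (X Y : C) (f : hom X Y), hadd (hopp f) f = hzero X Y;
  ccompDl : forall (X Y Z : C) (g g' : hom Y Z) (f : hom X Y),
    hadd g g' ∘ f = hadd (g ∘ f) (g' ∘ f);
  ccompDr : forall (X Y Z : C) (g : hom Y Z) (f f' : hom X Y),
    g ∘ hadd f f' = hadd (g ∘ f) (g ∘ f') }.

Definition is_additive (C : category) (A : preadditive C) : Prop :=
  pointed C /\
  forall X Y : C, exists (B : C) (i : hom X B) (j : hom Y B)
                         (p : hom B X) (q : hom B Y),
    [/\ p ∘ i = cid X, q ∘ j = cid Y, p ∘ j = hzero A Y X,
        q ∘ i = hzero A X Y & hadd A (i ∘ p) (j ∘ q) = cid B].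

Definition additive_functor (C D : category) (A : preadditive C)
    (B : preadditive D) (F : functor C D) : Prop :=
  forall (X Y : C) (f g : hom X Y),
    fmap F (hadd A f g) = hadd B (fmap F f) (fmap F g).

Definition triangle_class (C : category) (S : functor C C) :=
  forall X Y Z : C, hom X Y -> hom Y Z -> hom Z (S X) -> Prop.

Record triangle_data := TriangleData {
  tcat :> category;
  tadd : preadditive tcat;
  tshift : functor tcat tcat;
  texact : triangle_class tshift }.

Definition triangle_iso (C : category) (S : functor C C)
    (X Y Z : C) (f : hom X Y) (g : hom Y Z) (h : hom Z (S X))
    (X' Y' Z' : C) (f' : hom X' Y') (g' : hom Y' Z') (h' : hom Z' (S X')) :
    Prop :=
  exists (a : hom X X') (b : hom Y Y') (c : hom Z Z'),
    [/\ is_iso a, is_iso b & is_iso c] /\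
    [/\ f' ∘ a = b ∘ f, g' ∘ b = c ∘ g & h' ∘ c = fmap S a ∘ h].

Arguments triangle_iso {C} S {X Y Z} f g h {X' Y' Z'} f' g' h'.

Record is_triangulated (T : triangle_data) : Prop := IsTriangulated {
  tr_additive : is_additive (tadd T);
  tr_shift_additive : additive_functor (tadd T) (tadd T) (tshift T);
  tr_shift_equiv : is_equivalence (tshift T);
  tr_iso : forall (X Y Z : T) (f : hom X Y) (g : hom Y Z)
      (h : hom Z (tshift T X)) (X' Y' Z' : T) (f' : hom X' Y')
      (g' : hom Y' Z') (h' : hom Z' (tshift T X')),
    triangle_iso (tshift T) f g h f' g' h' ->
    texact f g h -> texact f' g' h';
  tr_id : forall X Z : T, is_zero Z ->
    texact (cid X) (hzero (tadd T) X Z) (hzero (tadd T) Z (tshift T X));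
  tr_cone : forall (X Y : T) (f : hom X Y),
    exists (Z : T) (g : hom Y Z) (h : hom Z (tshift T X)), texact f g h;
  tr_rotate : forall (X Y Z : T) (f : hom X Y) (g : hom Y Z)
      (h : hom Z (tshift T X)),
    texact f g h <-> texact g h (hopp (tadd T) (fmap (tshift T) f));
  tr_fill : forall (X Y Z : T) (f : hom X Y) (g : hom Y Z)
      (h : hom Z (tshift T X)) (X' Y' Z' : T) (f' : hom X' Y')
      (g' : hom Y' Z') (h' : hom Z' (tshift T X'))
      (a : hom X X') (b : hom Y Y'),
    texact f g h -> texact f' g' h' -> f' ∘ a = b ∘ f ->
    exists c : hom Z Z', g' ∘ b = c ∘ g /\ h' ∘ c = fmap (tshift T) a ∘ h;
  tr_octahedron : forall (X Y Z U V W : T) (f : hom X Y) (g : hom Y Z)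
      (f1 : hom Y U) (f2 : hom U (tshift T X))
      (g1 : hom Z V) (g2 : hom V (tshift T Y))
      (k1 : hom Z W) (k2 : hom W (tshift T X)),
    texact f f1 f2 -> texact g g1 g2 -> texact (g ∘ f) k1 k2 ->
    exists (u : hom U W) (v : hom W V),
      texact u v (fmap (tshift T) f1 ∘ g2) /\
      [/\ u ∘ f1 = k1 ∘ g, k2 ∘ u = f2,
          v ∘ k1 = g1 & g2 ∘ v = fmap (tshift T) f ∘ k2] }.

Record triangulated_category := TriangulatedCategory {
  tc_data :> triangle_data;
  tc_axioms : is_triangulated tc_data }.

Record full_triangulated_subcategory (T : triangulated_category) :=
  FullTriangulatedSubcategory {
    sub_mem : T -> Prop;
    sub_zero : forall Z : T, is_zero Z -> sub_mem Z;
    sub_replete : forall (X Y : T) (f : hom X Y),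
      is_iso f -> sub_mem X -> sub_mem Y;
    sub_shift : forall X : T, sub_mem X <-> sub_mem (tshift T X);
    sub_cone : forall (X Y Z : T) (f : hom X Y) (g : hom Y Z)
        (h : hom Z (tshift T X)),
      texact f g h -> sub_mem X -> sub_mem Y -> sub_mem Z }.

Section Subcategory.
Variables (T : triangulated_category) (P : full_triangulated_subcategory T).

Definition sub_cat : category :=
  @Category {X : T | sub_mem P X}
    (fun X Y => hom (sval X) (sval Y)) (fun X => cid (sval X))
    (fun X Y Z g f => g ∘ f)
    (fun X Y Z W h g f => ccompA h g f)
    (fun X Y f => ccomp1l f) (fun X Y f => ccomp1r f).

Definition sub_add : preadditive sub_cat :=
  @Preadditive sub_cat
    (fun X Y => hzero (tadd T) (sval X) (sval Y))
    (fun X Y f => hopp (tadd T) f)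
    (fun X Y f g => hadd (tadd T) f g)
    (fun X Y f g h => haddA (tadd T) f g h)
    (fun X Y f g => haddC (tadd T) f g)
    (fun X Y f => hadd0 (tadd T) f)
    (fun X Y f => haddN (tadd T) f)
    (fun X Y Z g g' f => ccompDl (tadd T) g g' f)
    (fun X Y Z g f f' => ccompDr (tadd T) g f f').

Definition sub_shift_functor : functor sub_cat sub_cat :=
  @Functor sub_cat sub_cat
    (fun X => exist _ (tshift T (sval X)) ((sub_shift P _).1 (svalP X)))
    (fun X Y f => fmap (tshift T) f)
    (fun X => fmap1 (tshift T) (sval X))
    (fun X Y Z g f => fmapM (tshift T) g f).

Definition sub_data : triangle_data :=
  @TriangleData sub_cat sub_add sub_shift_functor
    (fun X Y Z f g h => @texact T (sval X) (sval Y) (sval Z) f g h).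

End Subcategory.

Definition exact_functor (T T' : triangle_data) (F : functor T T') : Prop :=
  additive_functor (tadd T) (tadd T') F /\
  exists t : nat_trans (functor_comp F (tshift T)) (functor_comp (tshift T') F),
    is_nat_iso t /\
    forall (X Y Z : T) (f : hom X Y) (g : hom Y Z) (h : hom Z (tshift T X)),
      texact f g h ->
      @texact T' (F X) (F Y) (F Z) (fmap F f) (fmap F g) (t X ∘ fmap F h).

Definition exact_equivalent (T T' : triangle_data) : Prop :=
  exists F : functor T T', exact_functor F /\ is_equivalence F.

Definition is_limit (J C : category) (D : functor J C) (L : C)
    (p : forall j : J, hom L (D j)) : Prop :=
  (forall (j k : J) (f : hom j k), fmap D f ∘ p j = p k) /\
  forall (X : C) (q : forall j : J, hom X (D j)),
    (forall (j k : J) (f : hom j k), fmap D f ∘ q j = q k) ->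
    exists! u : hom X L, forall j, p j ∘ u = q j.

Definition is_colimit (J C : category) (D : functor J C) (L : C)
    (i : forall j : J, hom (D j) L) : Prop :=
  (forall (j k : J) (f : hom j k), i k ∘ fmap D f = i j) /\
  forall (X : C) (q : forall j : J, hom (D j) X),
    (forall (j k : J) (f : hom j k), q k ∘ fmap D f = q j) ->
    exists! u : hom L X, forall j, u ∘ i j = q j.

Definition finite_type (X : Type) : Prop :=
  exists (n : nat) (e : 'I_n -> X), forall x : X, exists i : 'I_n, e i = x.

Definition finite_category (J : category) : Prop :=
  finite_type J /\ forall j k : J, finite_type (hom j k).

Definition has_finite_limits (C : category) : Prop :=
  forall (J : category) (D : functor J C), finite_category J ->
    exists (L : C) (p : forall j : J, hom L (D j)), is_limit p.

Definition has_finite_colimits (C : category) : Prop :=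
  forall (J : category) (D : functor J C), finite_category J ->
    exists (L : C) (i : forall j : J, hom (D j) L), is_colimit i.

Definition is_pushout (C : category) (X Y Z P : C)
    (f : hom X Y) (g : hom X Z) (i : hom Y P) (j : hom Z P) : Prop :=
  i ∘ f = j ∘ g /\
  forall (W : C) (a : hom Y W) (b : hom Z W), a ∘ f = b ∘ g ->
    exists! u : hom P W, u ∘ i = a /\ u ∘ j = b.

Definition is_cofiber (C : category) (X Y Q : C)
    (f : hom X Y) (q : hom Y Q) : Prop :=
  exists (Z : C) (a : hom X Z) (b : hom Z Q), is_zero Z /\ is_pushout f a q b.

Definition map_class (C : category) := forall X Y : C, hom X Y -> Prop.

Definition has_lift (C : category) (A B X Y : C)
    (i : hom A B) (p : hom X Y) : Prop :=
  forall (a : hom A X) (b : hom B Y), p ∘ a = b ∘ i ->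
    exists l : hom B X, l ∘ i = a /\ p ∘ l = b.

Definition is_retract (C : category) (X Y X' Y' : C)
    (f : hom X Y) (g : hom X' Y') : Prop :=
  exists (s : hom X X') (r : hom X' X) (s' : hom Y Y') (r' : hom Y' Y),
    [/\ r ∘ s = cid X, r' ∘ s' = cid Y, g ∘ s = s' ∘ f & f ∘ r = r' ∘ g].

Definition closed_subcategory (C : category) (W : map_class C) : Prop :=
  [/\ forall X : C, W X X (cid X),
      forall (X Y Z : C) (g : hom Y Z) (f : hom X Y),
        W _ _ f -> W _ _ g -> W _ _ (g ∘ f)
    & forall (X Y X' Y' : C) (f : hom X Y) (g : hom X' Y'),
        is_retract f g -> W _ _ g -> W _ _ f].

Record model_category := ModelCategory {
  mcat :> category;
  weq : map_class mcat;
  cof : map_class mcat;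
  fib : map_class mcat;
  mc_limits : has_finite_limits mcat;
  mc_colimits : has_finite_colimits mcat;
  mc_weq : closed_subcategory weq;
  mc_cof : closed_subcategory cof;
  mc_fib : closed_subcategory fib;
  mc_two_of_three_l : forall (X Y Z : mcat) (g : hom Y Z) (f : hom X Y),
    weq f -> weq (g ∘ f) -> weq g;
  mc_two_of_three_r : forall (X Y Z : mcat) (g : hom Y Z) (f : hom X Y),
    weq g -> weq (g ∘ f) -> weq f;
  mc_lift_acyclic_cof : forall (A B X Y : mcat) (i : hom A B) (p : hom X Y),
    cof i -> weq i -> fib p -> has_lift i p;
  mc_lift_acyclic_fib : forall (A B X Y : mcat) (i : hom A B) (p : hom X Y),
    cof i -> fib p -> weq p -> has_lift i p;
  mc_factor_acyclic_cof : forall (X Y : mcat) (f : hom X Y),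
    exists (Z : mcat) (i : hom X Z) (p : hom Z Y),
      [/\ cof i, weq i, fib p & f = p ∘ i];
  mc_factor_acyclic_fib : forall (X Y : mcat) (f : hom X Y),
    exists (Z : mcat) (i : hom X Z) (p : hom Z Y),
      [/\ cof i, fib p, weq p & f = p ∘ i] }.

Definition cofibrant (M : model_category) (A : M) : Prop :=
  forall (Z : M) (i : hom Z A), is_initial Z -> cof i.

Definition contractible (M : model_category) (A : M) : Prop :=
  forall (Z : M) (p : hom A Z), is_terminal Z -> weq p.

Definition inverts (C D : category) (W : map_class C) (F : functor C D) : Prop :=
  forall (X Y : C) (f : hom X Y), W _ _ f -> is_iso (fmap F f).

(* Precomposition with [L] is an equivalence from functors out of [H] to
   functors out of [C] inverting [W]: essentially surjective, then fully
   faithful.  This determines [H] up to equivalence, compatibly with [L]. *)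
Definition is_localization (C H : category) (W : map_class C)
    (L : functor C H) : Prop :=
  [/\ inverts W L,
      forall (D : category) (F : functor C D), inverts W F ->
        exists (G : functor H D) (t : nat_trans (functor_comp G L) F),
          is_nat_iso t
    & forall (D : category) (G G' : functor H D)
        (t : nat_trans (functor_comp G L) (functor_comp G' L)),
        exists s : nat_trans G G', (forall X : C, s (L X) = t X) /\
          forall s' : nat_trans G G', (forall X : C, s' (L X) = t X) ->
            forall Y : H, s' Y = s Y].

Definition is_homotopy_category (M : model_category) (H : category)
    (L : functor M H) : Prop :=
  is_localization (@weq M) L.

(* A cofibration from [A] into a contractible object, with its cofiber: the
   latter is a model of the suspension of [A]. *)
Record cone_on (M : model_category) (A : M) := ConeOn {
  cone_ob : M;
  cone_in : hom A cone_ob;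
  cone_quot : M;
  cone_proj : hom cone_ob cone_quot;
  cone_in_cof : cof cone_in;
  cone_contractible : contractible cone_ob;
  cone_cofiber : is_cofiber cone_in cone_proj }.

(* The data exhibiting an endofunctor [S] of the homotopy category as the
   suspension functor.  It determines [S] up to a unique compatible natural
   isomorphism, since every object of the homotopy category is isomorphic to
   the image of a cofibrant object. *)
Record suspension (M : model_category) (H : category) (L : functor M H)
    (S : functor H H) := Suspension {
  susp_map : forall (A : M) (c : cone_on A), cofibrant A ->
    hom (L (cone_quot c)) (S (L A));
  susp_iso : forall (A : M) (c : cone_on A) (hA : cofibrant A),
    is_iso (susp_map c hA);
  susp_natural : forall (A A' : M) (c : cone_on A) (c' : cone_on A')
      (hA : cofibrant A) (hA' : cofibrant A') (a : hom A A')
      (b : hom (cone_ob c) (cone_ob c')) (s : hom (cone_quot c) (cone_quot c')),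
    b ∘ cone_in c = cone_in c' ∘ a -> s ∘ cone_proj c = cone_proj c' ∘ b ->
    susp_map c' hA' ∘ fmap L s = fmap S (fmap L a) ∘ susp_map c hA }.

Definition stable (M : model_category) : Prop :=
  pointed M /\
  forall (H : category) (L : functor M H) (S : functor H H),
    is_homotopy_category L -> suspension L S -> is_equivalence S.

Section CofiberSequences.
Variables (M : model_category) (H : category) (L : functor M H).
Variables (S : functor H H) (sigma : suspension L S).

(* For a cofibration [j : A -> B] with cofiber [p : B -> D], let [P] be the
   mapping cone of [j].  The connecting map is the composite in the homotopy
   category of the inverse of the weak equivalence [u : P -> D] collapsing the
   cone and the map [v : P -> cone_quot c] collapsing [B].  The opposite sign
   convention would give another triangulation, exact equivalent to this one
   by the identity functor and minus the identity of the suspension. *)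
Definition is_connecting_map (A B D : M) (hA : cofibrant A) (j : hom A B)
    (p : hom B D) (d : hom (L D) (S (L A))) : Prop :=
  exists (c : cone_on A) (P : M) (k : hom (cone_ob c) P) (l : hom B P)
         (u : hom P D) (v : hom P (cone_quot c)),
    [/\ is_pushout (cone_in c) j k l,
        is_zero_map (u ∘ k) /\ u ∘ l = p,
        v ∘ k = cone_proj c /\ is_zero_map (v ∘ l)
      & d ∘ fmap L u = susp_map sigma c hA ∘ fmap L v].

Definition cofiber_triangle (X Y Z : H) (f : hom X Y) (g : hom Y Z)
    (h : hom Z (S X)) : Prop :=
  exists (A B D : M) (j : hom A B) (p : hom B D) (hA : cofibrant A)
         (d : hom (L D) (S (L A))),
    [/\ cof j, is_cofiber j p, is_connecting_map hA j p d
      & triangle_iso S (fmap L j) (fmap L p) d f g h].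

End CofiberSequences.

Record triangulated_homotopy_category (M : model_category) :=
  TriangulatedHomotopyCategory {
    ho :> triangulated_category;
    ho_loc : functor M ho;
    ho_localization : is_homotopy_category ho_loc;
    ho_suspension : suspension ho_loc (tshift ho);
    ho_exact : forall (X Y Z : ho) (f : hom X Y) (g : hom Y Z)
        (h : hom Z (tshift ho X)),
      texact f g h <-> cofiber_triangle ho_suspension f g h }.

Local Open Scope ring_scope.

Definition finitely_generated (R : nzRingType) (M : lmodType R) : Prop :=
  exists (n : nat) (e : 'I_n -> M),
    forall x : M, exists a : 'I_n -> R, x = \sum_(i < n) a i *: e i.

Definition projective (R : nzRingType) (P : lmodType R) : Prop :=
  forall (M N : lmodType R) (g : {linear M -> N}) (f : {linear P -> N}),
    (forall y : N, exists x : M, g x = y) ->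
    exists h : {linear P -> M}, forall x : P, g (h x) = f x.

Record fgproj (R : nzRingType) := FgProj {
  fgproj_mod :> lmodType R;
  fgproj_fg : finitely_generated fgproj_mod;
  fgproj_projective : projective fgproj_mod }.

Lemma linear_ext (R : nzRingType) (M N : lmodType R) (f g : {linear M -> N}) :
  f =1 g -> f = g.
Proof.
case: f g => [f cf] [g cg] /= /funext fg; case: _ / fg cg => cg.
by congr GRing.Linear.Pack; case: cf cg => [[?] [?]] [[?] [?]];
   congr GRing.Linear.Class; congr (_ _); apply: Prop_irrelevance.
Qed.

Section ProjCat.
Variable R : nzRingType.

Program Definition proj_cat : category :=
  @Category (fgproj R) (fun M N => {linear M -> N})
    (fun M => idfun : {linear M -> M})
    (fun M N K (g : {linear N -> K}) (f : {linear M -> N}) =>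
       g \o f : {linear M -> K}) _ _ _.
Next Obligation. by apply: linear_ext. Qed.
Next Obligation. by apply: linear_ext. Qed.
Next Obligation. by apply: linear_ext. Qed.

Program Definition proj_add : preadditive proj_cat :=
  @Preadditive proj_cat
    (fun M N => \0 : {linear M -> N})
    (fun M N (f : {linear M -> N}) => \- f : {linear M -> N})
    (fun M N (f g : {linear M -> N}) => f \+ g : {linear M -> N})
    _ _ _ _ _ _.
Next Obligation. by apply: linear_ext => x /=; rewrite addrA. Qed.
Next Obligation. by apply: linear_ext => x /=; rewrite addrC. Qed.
Next Obligation. by apply: linear_ext => x /=; rewrite add0r. Qed.
Next Obligation. by apply: linear_ext => x /=; rewrite addNr. Qed.
Next Obligation. by apply: linear_ext. Qed.
Next Obligation.
by apply: linear_ext => x /=; rewrite linearD.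
Qed.

Definition proj_triangles (E : triangle_class (functor_id proj_cat)) :
    triangle_data :=
  @TriangleData proj_cat proj_add (functor_id proj_cat) E.

End ProjCat.

(* Main.v *)
(** [R = Z/4] sits in an exact triangle [R -2-> R -2-> R -2-> R], and
   its image [X] in [Ho M] would sit in a similar triangle [T].  In [Ho M],
   twice the identity of a triangle is realized by a strict map of cofiber
   sequences, so it factors as [T -> (X -> P -> X) -> T], where the first map
   is the identity on the third object and the second one on the first object,
   [P] being a pushout.  As [End X = Z/4], matching the connecting map of the
   middle triangle against the four possibilities rules this out: if it is
   zero then [P] splits and the composite on the second object is [2 + 2 = 0]
   instead of [2].

   The strict map is obtained from a cylinder [Q]: doubling is the map from
   two consecutive copies of [Q], with the outer ends collapsed, to the
   quotient [Y] of [Q] by its ends (a model of the suspension) which is the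
   quotient map on each copy.  It is natural in the cylinder, and is the sum of
   the two maps collapsing one of the copies, which are weak equivalences and
   agree in [Ho M]. *)
From HB Require Import structures.
From mathcomp Require Import all_boot all_algebra.
From mathcomp Require Import boolp.
Require Import Defs.

Set Implicit Arguments.
Unset Strict Implicit.
Unset Printing Implicit Defensive.

Local Open Scope cat_scope.

(** * Categories with a zero object *)

Section Composition.
Variable C : category.
Implicit Types X Y Z W : C.

Lemma comp_congr X Y Z W (h : hom Z W) (g : hom Y Z) (f : hom X Y) k :
  g ∘ f = k -> h ∘ g ∘ f = h ∘ k.
Proof. by move<-; rewrite ccompA. Qed.

Lemma is_iso_id X : is_iso (cid X).
Proof. by exists (cid X); rewrite !ccomp1l. Qed.

Lemma is_iso_comp X Y Z (g : hom Y Z) (f : hom X Y) :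
  is_iso f -> is_iso g -> is_iso (g ∘ f).
Proof.
move=> [f' [f1 f2]] [g' [g1 g2]]; exists (f' ∘ g').
by rewrite !ccompA (comp_congr _ g1) (comp_congr _ f2) !ccomp1r.
Qed.

End Composition.

Lemma is_iso_fmap (C D : category) (F : functor C D) (X Y : C) (f : hom X Y) :
  is_iso f -> is_iso (fmap F f).
Proof. by case=> g [e e']; exists (fmap F g); rewrite -!fmapM e e' !fmap1. Qed.

Lemma equivalence_faithful (C D : category) (F : functor C D) (X Y : C)
    (f g : hom X Y) : is_equivalence F -> fmap F f = fmap F g -> f = g.
Proof.
case=> G [a [_ [ha _]]] e.
have [a' [_ aK]] := ha X.
have: f ∘ a X = g ∘ a X.
  by have /= <- := nt_natural a f; have /= <- := nt_natural a g; rewrite e.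
by move/(congr1 (fun u => u ∘ a')); rewrite -!ccompA aK !ccomp1r.
Qed.

(** The preimage is [G u] conjugated by the natural isomorphism [a]. As [G] is itself an
    equivalence, hence faithful, [fmap F f = u] can be checked after applying [G], where it follows
    from naturality of [a]. *)
Lemma equivalence_full (C D : category) (F : functor C D) (X Y : C)
    (u : hom (F X) (F Y)) : is_equivalence F -> exists f, fmap F f = u.
Proof.
move=> [G [a [b [ha hb]]]].
have hG : is_equivalence G by exists F, b, a.
have [x [xa ax]] := ha X; have [y [ya ay]] := ha Y.
exists (a Y ∘ fmap G u ∘ x); apply: (equivalence_faithful hG).
have e : a Y ∘ fmap G (fmap F (a Y ∘ fmap G u ∘ x)) = a Y ∘ fmap G u ∘ x ∘ a X.
  exact (nt_natural a (a Y ∘ fmap G u ∘ x)).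
move/(congr1 (fun v => y ∘ v)): e.
by rewrite !ccompA ya !ccomp1l (comp_congr _ xa) ccomp1r.
Qed.

Section ZeroMaps.
Variables (C : category) (hC : pointed C).
Implicit Types X Y Z W T : C.

(** [boolp.cid] is the choice principle of classical logic, not the identity morphism [cid]. *)
Definition zero_ob : C := sval (boolp.cid hC).

Lemma zero_obP : is_zero zero_ob.
Proof. exact: svalP (boolp.cid hC). Qed.

Lemma is_zero_map_eq X Y (f g : hom X Y) :
  is_zero_map f -> is_zero_map g -> f = g.
Proof.
case=> Z [a [b [[hi ht] ->]]]; case=> Z' [a' [b' [[hi' ht'] ->]]].
have [c _] := hi Z'; have [d _] := hi' Z.
have [k hk] := hi Z.
have e : d ∘ c = cid Z by rewrite (hk (cid Z)) (hk (_ ∘ _)).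
rewrite -(ccomp1l a) -e !ccompA -ccompA; congr (_ ∘ _).
  by have [m hm] := hi' Y; rewrite (hm (b ∘ d)) (hm b').
by have [m hm] := ht' X; rewrite (hm (c ∘ a)) (hm a').
Qed.

Lemma zero_map_exists X Y : exists f : hom X Y, is_zero_map f.
Proof.
have [a _] := zero_obP.2 X; have [b _] := zero_obP.1 Y.
by exists (b ∘ a), zero_ob, a, b; split=> //; apply: zero_obP.
Qed.

Definition zero_map X Y : hom X Y := sval (boolp.cid (zero_map_exists X Y)).

Local Notation "'0" := (zero_map _ _) (at level 0).

Lemma zero_map_is_zero X Y : is_zero_map (zero_map X Y).
Proof. exact: svalP (boolp.cid (zero_map_exists X Y)). Qed.

Lemma zero_mapP X Y (f : hom X Y) : is_zero_map f -> f = '0.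
Proof. by move=> h; apply: is_zero_map_eq h (zero_map_is_zero X Y). Qed.

Lemma zero_map_through X Y Z (a : hom X Z) (b : hom Z Y) :
  is_zero Z -> b ∘ a = '0.
Proof. by move=> hZ; apply: zero_mapP; exists Z, a, b. Qed.

Lemma comp_zero X Y Z (f : hom Y Z) : f ∘ zero_map X Y = '0.
Proof.
have [T [a [b [hT ->]]]] := zero_map_is_zero X Y.
by rewrite ccompA; apply: zero_map_through.
Qed.

Lemma zero_comp X Y Z (f : hom X Y) : zero_map Y Z ∘ f = '0.
Proof.
have [T [a [b [hT ->]]]] := zero_map_is_zero Y Z.
by rewrite -ccompA; apply: zero_map_through.
Qed.

Lemma is_zeroP X : is_zero X <-> cid X = '0.
Proof.
split=> [hX|e]; first by rewrite -(ccomp1l (cid X)); apply: zero_map_through.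
split=> Y; exists '0 => g; first by rewrite -(ccomp1r g) e comp_zero.
by rewrite -(ccomp1l g) e zero_comp.
Qed.

Lemma from_zero_eq X Y (f g : hom X Y) : is_zero X -> f = g.
Proof. by case=> h _; have [m hm] := h Y; rewrite (hm f) (hm g). Qed.

Lemma to_zero_eq X Y (f g : hom X Y) : is_zero Y -> f = g.
Proof. by case=> _ h; have [m hm] := h X; rewrite (hm f) (hm g). Qed.

Lemma initial_is_zero X : is_initial X -> is_zero X.
Proof. by move=> h; apply/is_zeroP; have [m hm] := h X; rewrite (hm (cid X)) [RHS]hm. Qed.

Lemma terminal_is_zero X : is_terminal X -> is_zero X.
Proof. by move=> h; apply/is_zeroP; have [m hm] := h X; rewrite (hm (cid X)) [RHS]hm. Qed.

(** This is [is_cofiber] with the auxiliary zero object eliminated; see [cofiberP]. *)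
Definition is_coker X Y Q (f : hom X Y) (q : hom Y Q) : Prop :=
  q ∘ f = '0 /\
  forall T (a : hom Y T), a ∘ f = '0 -> exists! u : hom Q T, u ∘ q = a.

Definition is_coprod X Y S (i : hom X S) (j : hom Y S) : Prop :=
  forall T (a : hom X T) (b : hom Y T),
    exists! u : hom S T, u ∘ i = a /\ u ∘ j = b.

Lemma coker_desc X Y Q (f : hom X Y) (q : hom Y Q) : is_coker f q ->
  forall T (a : hom Y T), a ∘ f = '0 -> exists u : hom Q T, u ∘ q = a.
Proof. by move=> [_ h] T a /h [u [e _]]; exists u. Qed.

Lemma coker_epi X Y Q (f : hom X Y) (q : hom Y Q) : is_coker f q ->
  forall T (u v : hom Q T), u ∘ q = v ∘ q -> u = v.
Proof.
move=> [e h] T u v euv.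
have [|w [_ hw]] := h T (u ∘ q); first by rewrite -ccompA e comp_zero.
by rewrite -(hw u) // -(hw v).
Qed.

Lemma coprod_desc X Y S (i : hom X S) (j : hom Y S) : is_coprod i j ->
  forall T (a : hom X T) (b : hom Y T),
    exists u : hom S T, u ∘ i = a /\ u ∘ j = b.
Proof. by move=> h T a b; have [u [e _]] := h T a b; exists u. Qed.

Lemma coprod_epi X Y S (i : hom X S) (j : hom Y S) : is_coprod i j ->
  forall T (u v : hom S T), u ∘ i = v ∘ i -> u ∘ j = v ∘ j -> u = v.
Proof.
move=> h T u v e1 e2; have [w [_ hw]] := h T (u ∘ i) (u ∘ j).
by rewrite -(hw u) // -(hw v).
Qed.

Lemma pushout_desc X Y Z S (f : hom X Y) (g : hom X Z) (i : hom Y S)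
    (j : hom Z S) : is_pushout f g i j ->
  forall T (a : hom Y T) (b : hom Z T), a ∘ f = b ∘ g ->
    exists u : hom S T, u ∘ i = a /\ u ∘ j = b.
Proof. by move=> [_ h] T a b /h [u [e _]]; exists u. Qed.

Lemma pushout_epi X Y Z S (f : hom X Y) (g : hom X Z) (i : hom Y S)
    (j : hom Z S) : is_pushout f g i j ->
  forall T (u v : hom S T), u ∘ i = v ∘ i -> u ∘ j = v ∘ j -> u = v.
Proof.
move=> [e h] T u v e1 e2; have [|w [_ hw]] := h T (u ∘ i) (u ∘ j).
  by rewrite -!ccompA e.
by rewrite -(hw u) // -(hw v).
Qed.

Lemma pushoutC X Y Z S (f : hom X Y) (g : hom X Z) (i : hom Y S)
    (j : hom Z S) : is_pushout f g i j -> is_pushout g f j i.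
Proof.
move=> h; split=> [|T a b e]; first by case: h.
have [u [e1 e2]] := pushout_desc h (esym e); exists u; split=> // v [e3 e4].
by apply: (pushout_epi h); rewrite ?e1 ?e2.
Qed.

Lemma cofiberP X Y Q (f : hom X Y) (q : hom Y Q) :
  is_cofiber f q <-> is_coker f q.
Proof.
split.
  case=> Z [a [b [hZ h]]]; split=> [|T c e].
    by have [-> _] := h; apply: zero_map_through.
  have [|u [e1 e2]] := pushout_desc h (a := c) (b := '0).
    by rewrite e zero_comp.
  exists u; split=> // v ev; apply: (pushout_epi h); first by rewrite e1.
  exact: from_zero_eq.
move=> h; exists zero_ob, '0, '0; split; first exact: zero_obP.
split=> [|T a b e]; first by case: h => -> _; rewrite comp_zero.
have [|u eu] := coker_desc h (a := a); first by rewrite e comp_zero.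
exists u; split; first by split=> //; apply: from_zero_eq zero_obP.
by move=> v [ev _]; apply: (coker_epi h); rewrite eu.
Qed.

Lemma is_coker_id X : is_coker (cid X) (zero_map X zero_ob).
Proof.
split=> [|T a]; first by rewrite ccomp1r.
rewrite ccomp1r => ->; exists '0; split; first by rewrite comp_zero.
by move=> v _; apply: from_zero_eq zero_obP.
Qed.

Lemma coker_pushout X Y Z S Q (f : hom X Y) (g : hom X Z) (i : hom Y S)
    (j : hom Z S) (q : hom Y Q) (t : hom S Q) :
  is_pushout f g i j -> is_coker f q -> t ∘ i = q -> t ∘ j = '0 ->
  is_coker j t.
Proof.
move=> h hq ti tj; split=> // T a ea.
have [|u eu] := coker_desc hq (a := a ∘ i).
  by have [e _] := h; rewrite -ccompA e ccompA ea zero_comp.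
exists u; split.
  by apply: (pushout_epi h); rewrite -ccompA ?ti ?tj ?comp_zero ?ea.
by move=> v ev; apply: (coker_epi hq); rewrite eu -ti -ev !ccompA.
Qed.

Lemma coprod_coker X Y S (i : hom X S) (j : hom Y S) (q : hom S Y) :
  is_coprod i j -> q ∘ i = '0 -> q ∘ j = cid Y -> is_coker i q.
Proof.
move=> h e1 e2; split=> // T a ea; exists (a ∘ j); split.
  apply: (coprod_epi h); rewrite -ccompA ?e1 ?e2 ?comp_zero ?ea //.
  by rewrite ccomp1r.
by move=> v <-; rewrite -ccompA e2 ccomp1r.
Qed.

End ZeroMaps.

(** * Pushouts, coproducts and cokernels from finite colimits *)

Inductive span_ob := SpanApex | SpanLeft | SpanRight.

Definition span_hom (x y : span_ob) : Type :=
  match x, y with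
  | SpanApex, _ | SpanLeft, SpanLeft | SpanRight, SpanRight => unit
  | _, _ => Empty_set
  end.

Program Definition span_cat : category :=
  @Category span_ob span_hom
    (fun x => match x return span_hom x x with
              | SpanApex | SpanLeft | SpanRight => tt end)
    (fun x y z => match x, y, z
       return span_hom y z -> span_hom x y -> span_hom x z with
       | SpanApex, _, _ | SpanLeft, _, SpanLeft
       | SpanRight, _, SpanRight => fun _ _ => tt
       | SpanLeft, SpanLeft, _ => fun g _ => g
       | SpanRight, SpanRight, _ => fun g _ => g
       | SpanLeft, SpanApex, _ | SpanLeft, SpanRight, _
       | SpanRight, SpanApex, _ | SpanRight, SpanLeft, _ =>
           fun _ (f : Empty_set) => match f with end
       end) _ _ _.
Next Obligation. by case: X Y Z W f g h => [] [] [] [] //= [] // [] []. Qed.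
Next Obligation. by case: X Y f => [] [] // []. Qed.
Next Obligation. by case: X Y f => [] [] // []. Qed.

Lemma span_cat_finite : finite_category span_cat.
Proof.
split=> [|x y].
  exists 3, (fun i => nth SpanApex [:: SpanApex; SpanLeft; SpanRight] i).
  by case; [exists (inord 0) | exists (inord 1) | exists (inord 2)];
     rewrite inordK.
have fin_unit : finite_type unit.
  by exists 1%N, (fun=> tt) => -[]; exists ord0.
have fin_empty : finite_type Empty_set.
  by exists 0%N, (fun i : 'I_0 => match notF (ltn_ord i) with end) => -[].
by case: x y => [] [].
Qed.

Program Definition span_diagram (C : category) (X Y Z : C) (f : hom X Y)
    (g : hom X Z) : functor span_cat C :=
  @Functor span_cat C
    (fun x => match x with SpanApex => X | SpanLeft => Y | SpanRight => Z end)
    (fun x y => match x, y return span_hom x y ->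
        hom (match x with SpanApex => X | SpanLeft => Y | SpanRight => Z end)
            (match y with SpanApex => X | SpanLeft => Y | SpanRight => Z end)
       with
       | SpanApex, SpanApex | SpanLeft, SpanLeft | SpanRight, SpanRight =>
           fun _ => cid _
       | SpanApex, SpanLeft => fun _ => f
       | SpanApex, SpanRight => fun _ => g
       | SpanLeft, SpanApex | SpanLeft, SpanRight
       | SpanRight, SpanApex | SpanRight, SpanLeft =>
           fun e : Empty_set => match e with end
       end) _ _.
Next Obligation. by case: X0. Qed.
Next Obligation.
by case: X0 Y0 Z0 f0 g0 => [] [] [] //= [] [] //;
   rewrite ?ccomp1l ?ccomp1r.
Qed.

Lemma pushout_exists (C : category) (X Y Z : C) (f : hom X Y) (g : hom X Z) :
  has_finite_colimits C -> exists S (i : hom Y S) (j : hom Z S),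
    is_pushout f g i j.
Proof.
move=> hC; have [S [i [hi hU]]] := hC _ (span_diagram f g) span_cat_finite.
have el : i SpanLeft ∘ f = i SpanApex := hi SpanApex SpanLeft tt.
have er : i SpanRight ∘ g = i SpanApex := hi SpanApex SpanRight tt.
exists S, (i SpanLeft), (i SpanRight); split=> [|T a b e].
  by rewrite el er.
pose q (x : span_ob) : hom (span_diagram f g x) T :=
  match x with SpanApex => a ∘ f | SpanLeft => a | SpanRight => b end.
have [|u [hu hq]] := hU T q.
  by case=> [] [] //= [] //=; rewrite ?ccomp1r.
exists u; split; first by split; [exact: (hu SpanLeft)|exact: (hu SpanRight)].
move=> v [hl hr]; apply: hq => -[] //=.
by rewrite -el ccompA hl.
Qed.

Section PointedColimits.
Variables (C : category) (hC : pointed C) (hcolim : has_finite_colimits C).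

Lemma coprod_exists (X Y : C) :
  exists S (i : hom X S) (j : hom Y S), is_coprod i j.
Proof.
have [S [i [j h]]] := pushout_exists (zero_map hC (zero_ob hC) X)
  (zero_map hC (zero_ob hC) Y) hcolim.
exists S, i, j => T a b.
have [|u eu] := pushout_desc h (a := a) (b := b).
  by apply: from_zero_eq (zero_obP hC).
exists u; split=> // v [e1 e2]; case: eu => e3 e4.
by apply: (pushout_epi h); rewrite ?e1 ?e2 ?e3 ?e4.
Qed.

Lemma coker_exists (X Y : C) (f : hom X Y) :
  exists Q (q : hom Y Q), is_coker hC f q.
Proof.
have [Q [q [j h]]] := pushout_exists f (zero_map hC X (zero_ob hC)) hcolim.
exists Q, q; apply/cofiberP; exists (zero_ob hC); do 2!eexists.
by split; [exact: zero_obP|exact: h].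
Qed.

End PointedColimits.

(** * Cofibrations and cylinders *)

Section Cofibrations.
Variables (M : model_category) (hM : pointed M).
Implicit Types A B X Y Z : M.

Local Notation "'0" := (zero_map hM _ _) (at level 0).

Lemma weq_id X : weq (cid X).
Proof. by have [h _ _] := mc_weq M. Qed.

Lemma weq_comp X Y Z (g : hom Y Z) (f : hom X Y) :
  weq f -> weq g -> weq (g ∘ f).
Proof. by have [_ h _] := mc_weq M; apply: h. Qed.

Lemma cof_comp X Y Z (g : hom Y Z) (f : hom X Y) :
  cof f -> cof g -> cof (g ∘ f).
Proof. by have [_ h _] := mc_cof M; apply: h. Qed.

Lemma lift_retract A B Z (i : hom A B) (c : hom A Z) (p : hom Z B) :
  has_lift i p -> i = p ∘ c -> is_retract i c.
Proof.
move=> h e; have [|l [e1 e2]] := h c (cid B); first by rewrite ccomp1l.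
by exists (cid A), (cid A), l, p; rewrite !ccomp1r ?ccomp1l.
Qed.

(** The converse factors [i] as a cofibration followed by an acyclic fibration and applies the
    retract argument [lift_retract]. From here on cofibrations are recognized by solving lifting
    problems. *)
Lemma cofP A B (i : hom A B) :
  cof i <-> forall X Y (p : hom X Y), fib p -> weq p -> has_lift i p.
Proof.
split=> [hi X Y p fp wp|h]; first exact: mc_lift_acyclic_fib.
have [Z [c [p [cc fp wp e]]]] := mc_factor_acyclic_fib i.
have [_ _ hr] := mc_cof M; apply: (hr _ _ _ _ _ _ _ cc).
exact: lift_retract (h _ _ _ fp wp) e.
Qed.

Lemma acyclic_cofP A B (i : hom A B) :
  cof i /\ weq i <-> forall X Y (p : hom X Y), fib p -> has_lift i p.
Proof.
split=> [[hi wi] X Y p fp|h]; first exact: mc_lift_acyclic_cof.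
have [Z [c [p [cc wc fp e]]]] := mc_factor_acyclic_cof i.
have hret := lift_retract (h _ _ _ fp) e.
have [_ _ hr] := mc_cof M; have [_ _ hr'] := mc_weq M.
by split; [apply: hr hret cc|apply: hr' hret wc].
Qed.

Lemma lift_pushout X Y Z S (f : hom X Y) (g : hom X Z) (i : hom Y S)
    (j : hom Z S) A B (p : hom A B) :
  is_pushout f g i j -> has_lift f p -> has_lift j p.
Proof.
move=> h hf a b e.
have [|l [e1 e2]] := hf (a ∘ g) (b ∘ i).
  by rewrite ccompA e -!ccompA; case: h => ->.
have [u [e3 e4]] := pushout_desc h e1.
by exists u; split=> //; apply: (pushout_epi h); rewrite -ccompA ?e3 ?e4.
Qed.

Lemma cof_pushout X Y Z S (f : hom X Y) (g : hom X Z) (i : hom Y S)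
    (j : hom Z S) : is_pushout f g i j -> cof f -> cof j.
Proof.
move=> h /cofP hf; apply/cofP => A B p fp wp.
exact: lift_pushout h (hf _ _ _ fp wp).
Qed.

Lemma acyclic_cof_pushout X Y Z S (f : hom X Y) (g : hom X Z) (i : hom Y S)
    (j : hom Z S) : is_pushout f g i j -> cof f -> weq f -> weq j.
Proof.
move=> h cf wf; suff [] : cof j /\ weq j by [].
have /acyclic_cofP hf := conj cf wf; apply/acyclic_cofP => A B p fp.
exact: lift_pushout h (hf _ _ _ fp).
Qed.

Lemma cofibrantP A : cofibrant A <->
  forall X Y (p : hom X Y), fib p -> weq p ->
    forall b : hom A Y, exists l : hom A X, p ∘ l = b.
Proof.
split=> [hA X Y p fp wp b|h Z i hZ].
  have /cofP hi := hA _ (zero_map hM (zero_ob hM) A) (zero_obP hM).1.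
  have [|l [_ e]] := hi _ _ _ fp wp '0 b; first by rewrite !comp_zero.
  by exists l.
apply/cofP => X Y p fp wp a b _; have [l e] := h _ _ _ fp wp b.
by exists l; split=> //; apply: from_zero_eq (initial_is_zero hM hZ).
Qed.

Lemma cofibrant_cof A B (j : hom A B) : cofibrant A -> cof j -> cofibrant B.
Proof.
move=> /cofibrantP hA /cofP hj; apply/cofibrantP => X Y p fp wp b.
have [a ea] := hA _ _ _ fp wp (b ∘ j); have [l [_ el]] := hj _ _ _ fp wp _ _ ea.
by exists l.
Qed.

Lemma cof_coker_cofibrant A B D (j : hom A B) (g : hom B D) :
  cof j -> is_coker hM j g -> cofibrant D.
Proof.
move=> /cofP hj hg; apply/cofibrantP => X Y p fp wp b.
have [|l [e1 e2]] := hj _ _ _ fp wp '0 (b ∘ g).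
  by rewrite comp_zero -ccompA (hg.1) comp_zero.
have [u eu] := coker_desc hg e1; exists u.
by apply: (coker_epi hg); rewrite -ccompA eu.
Qed.

Lemma weq_iso X Y (f : hom X Y) : is_iso f -> weq f.
Proof.
case=> g [gf fg]; have [_ _ hr] := mc_weq M; apply: (hr _ _ _ _ _ _ _ (weq_id Y)).
by exists f, g, (cid Y), (cid Y); rewrite ?ccomp1l ?ccomp1r.
Qed.

Lemma contractible_weq A Z (f : hom A Z) :
  contractible A -> is_zero Z -> weq f.
Proof. by move=> hA hZ; apply: hA; case: hZ. Qed.

Lemma weq_contractible A Z (f : hom Z A) : is_zero Z -> weq f -> contractible A.
Proof.
move=> hZ wf T p hT; apply: (mc_two_of_three_l wf); apply: weq_iso.
exists (zero_map hM T Z).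
by split; [apply: to_zero_eq | apply: to_zero_eq (terminal_is_zero hM hT)].
Qed.

(** The inclusion is a pushout of [0 -> B]; the lift on the summand [B] comes from cofibrancy. *)
Lemma coprod_cof_l A B S (i : hom A S) (j : hom B S) :
  is_coprod i j -> cofibrant B -> cof i.
Proof.
move=> h /cofibrantP hB; apply/cofP => X Y p fp wp a b e.
have [l el] := hB _ _ _ fp wp (b ∘ j).
have [u [e1 e2]] := coprod_desc h a l; exists u; split=> //.
by apply: (coprod_epi h); rewrite -ccompA ?e1 ?e2.
Qed.

(* With [R] a cylinder of [P] and [K] embedded at its first end, the first end
   identifies [P / K] with [R / K] and the second end identifies [P] with
   [R / K]. *)
Lemma cone_quotient_weq K P Q (i : hom K P) (q : hom P Q) :
  cofibrant K -> contractible K -> cof i -> is_coker hM i q -> weq q.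
Proof.
move=> hK cK ci hq; have hP := cofibrant_cof hK ci.
(* Two out of three: the composite of [0 -> K] with [K -> 0] is an isomorphism. *)
have wK : weq (zero_map hM (zero_ob hM) K).
  apply: (@mc_two_of_three_r M _ _ _ (zero_map hM K (zero_ob hM))).
    exact: contractible_weq cK (zero_obP hM).
  by apply: weq_iso; exists '0; split; apply: from_zero_eq (zero_obP hM).
have aK : cof (zero_map hM (zero_ob hM) K) by apply: hK; case: (zero_obP hM).
have /acyclic_cofP liftK := conj aK wK.
have [S [n1 [n2 hS]]] := coprod_exists hM (@mc_colimits M) P P.
have [m [m1 m2]] := coprod_desc hS (cid P) (cid P).
(* [R] is a cylinder of [P], from a factorization of the fold map; its ends [c ∘ n1] and [c ∘ n2]
   are sections of [w], hence weak equivalences. *)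
have [R [c [w [cc fw ww em]]]] := mc_factor_acyclic_fib m.
have w1 : w ∘ (c ∘ n1) = cid P by rewrite ccompA -em.
have w2 : w ∘ (c ∘ n2) = cid P by rewrite ccompA -em.
have wc (n : hom P S) : w ∘ (c ∘ n) = cid P -> weq (c ∘ n).
  by move=> e; apply: (mc_two_of_three_r ww); rewrite e; apply: weq_id.
have /cofP liftc := cc.
have /cofP lifti := ci.
have /cofibrantP liftP := hP.
(* [E] is [R / K] with [K] at the first end. *)
have [E [e he]] := coker_exists hM (@mc_colimits M) (c ∘ n1 ∘ i).
have [N [u [v hN]]] := coprod_exists hM (@mc_colimits M) K P.
have [k [k1 k2]] := coprod_desc hN (c ∘ n1 ∘ i) (c ∘ n2).
have wv : weq v.
  suff [] : cof v /\ weq v by [].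
  apply/acyclic_cofP => X Y p fp a b ea.
  have [|l [_ el]] := liftK _ _ _ fp '0 (b ∘ u); first by rewrite !comp_zero.
  have [x [x1 x2]] := coprod_desc hN l a; exists x; split=> //.
  by apply: (coprod_epi hN); rewrite -ccompA ?x1 ?x2.
(* [k] puts [K] at the first end and [P] at the second. It is a weak equivalence because [c ∘ n2]
   and [v], a pushout of [0 -> K], are. As a cofibration: extend a lift from [K] to the first copy
   of [P], then over [R]. *)
have /acyclic_cofP liftk : cof k /\ weq k.
  split; last by apply: (mc_two_of_three_l wv); rewrite k2; apply: wc.
  apply/cofP => X Y p fp wp a b ea.
  have [|l [l1 l2]] := lifti _ _ _ fp wp (a ∘ u) (b ∘ c ∘ n1).
    by rewrite ccompA ea -!ccompA k1 !ccompA.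
  have [x [x1 x2]] := coprod_desc hS l (a ∘ v).
  have [|y [y1 y2]] := liftc _ _ _ fp wp x b.
    apply: (coprod_epi hS); rewrite -ccompA ?x1 ?x2 //.
    by rewrite ccompA ea -!ccompA k2.
  exists y; split=> //; apply: (coprod_epi hN); rewrite -ccompA ?k1 ?k2 !ccompA.
    by rewrite y1 x1.
  by rewrite y1 x2.
(* This is the pushout of [k] along the map [K + P -> P] collapsing [K]. *)
have wecn : weq (e ∘ (c ∘ n2)).
  suff [] : cof (e ∘ (c ∘ n2)) /\ weq (e ∘ (c ∘ n2)) by [].
  apply/acyclic_cofP => X Y p fp a b ea.
  have [x [x1 x2]] := coprod_desc hN '0 a.
  have [|l [l1 l2]] := liftk _ _ _ fp x (b ∘ e).
    apply: (coprod_epi hN); rewrite -!ccompA ?k1 ?k2 ?x1 ?x2 //.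
    by rewrite he.1 !comp_zero.
  have [|y ey] := coker_desc he (a := l); first by rewrite -k1 ccompA l1 x1.
  exists y; split; first by rewrite !ccompA ey -ccompA -k2 ccompA l1 x2.
  by apply: (coker_epi he); rewrite -ccompA ey.
(* [d : P / K -> R / K] comes from the first end and is a pushout of the acyclic cofibration
   [c ∘ n1]. *)
have [|d ed] := coker_desc hq (a := e ∘ (c ∘ n1)).
  by rewrite -ccompA he.1.
have wd : weq d.
  suff [] : cof d /\ weq d by [].
  apply/acyclic_cofP => X Y p fp a b ea.
  have hcn1 : cof (c ∘ n1) /\ weq (c ∘ n1).
    by split; [apply: cof_comp cc; apply: coprod_cof_l hS hP | apply: wc].
  have /acyclic_cofP lift1 := hcn1.
  have [|l [l1 l2]] := lift1 _ _ _ fp (a ∘ q) (b ∘ e).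
    by rewrite ccompA ea -!ccompA ed.
  have [|y ey] := coker_desc he (a := l).
    by rewrite ccompA l1 -ccompA hq.1 comp_zero.
  exists y; split.
    by apply: (coker_epi hq); rewrite -ccompA ed ccompA ey.
  by apply: (coker_epi he); rewrite -ccompA ey.
(* [w'] is a retraction of [d], hence a weak equivalence, and [q] is [w'] after the second end. *)
have [|w' ew'] := coker_desc he (a := q ∘ w).
  by rewrite -ccompA (ccompA w) w1 ccomp1l hq.1.
have eq : q = w' ∘ (e ∘ (c ∘ n2)).
  by rewrite ccompA ew' -ccompA w2 ccomp1r.
have ww' : weq w'.
  apply: (mc_two_of_three_l wd).
  suff -> : w' ∘ d = cid Q by apply: weq_id.
  by apply: (coker_epi hq); rewrite -ccompA ed ccompA ew' -ccompA w1 ccomp1r ccomp1l.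
by rewrite eq; apply: weq_comp.
Qed.

End Cofibrations.

Section Cylinders.
Variables (M : model_category) (hM : pointed M).
Implicit Types A B D Q X Y Z : M.

Local Notation "'0" := (zero_map hM _ _) (at level 0).
Local Notation hcolim := (@mc_colimits M).

(* Equivalently, [i0] and [i1] together form a cofibration [A + A -> Q]. *)
Definition boundary_lift A Q (i0 i1 : hom A Q) : Prop :=
  forall X Y (p : hom X Y), fib p -> weq p ->
  forall (a0 a1 : hom A X) (b : hom Q Y),
    p ∘ a0 = b ∘ i0 -> p ∘ a1 = b ∘ i1 ->
    exists l : hom Q X, [/\ l ∘ i0 = a0, l ∘ i1 = a1 & p ∘ l = b].

Definition is_cylinder A Q (i0 i1 : hom A Q) (r : hom Q A) : Prop :=
  [/\ cofibrant A, boundary_lift i0 i1, weq i0 /\ weq i1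
    & r ∘ i0 = cid A /\ r ∘ i1 = cid A].

(* Equivalently, the map from the pushout of [B + B] and [Q] over [A + A] to
   [Q'] is a cofibration. *)
Definition relative_lift A B Q Q' (j : hom A B) (q : hom Q Q')
    (i0 i1 : hom A Q) (i0' i1' : hom B Q') : Prop :=
  forall X Y (p : hom X Y), fib p -> weq p ->
  forall (a0 a1 : hom B X) (c : hom Q X) (b : hom Q' Y),
    a0 ∘ j = c ∘ i0 -> a1 ∘ j = c ∘ i1 ->
    p ∘ a0 = b ∘ i0' -> p ∘ a1 = b ∘ i1' -> p ∘ c = b ∘ q ->
    exists l : hom Q' X, [/\ l ∘ i0' = a0, l ∘ i1' = a1, l ∘ q = c & p ∘ l = b].

Lemma cylinder_cofibrant A Q (i0 i1 : hom A Q) r :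
  is_cylinder i0 i1 r -> cofibrant Q.
Proof.
move=> [/(cofibrantP hM) hA hb _ _]; apply/(cofibrantP hM) => X Y p fp wp b.
have [a0 e0] := hA _ _ _ fp wp (b ∘ i0).
have [a1 e1] := hA _ _ _ fp wp (b ∘ i1).
by have [l [_ _ el]] := hb _ _ _ fp wp _ _ _ e0 e1; exists l.
Qed.

(** Glue [Q] to [B + B] along [A + A] and factor the map from the result to [B] as a cofibration
    followed by an acyclic fibration. The middle object is [Q'], and the relative lifting property
    is that of the cofibration. *)
Lemma cylinder_relative A B Q (j : hom A B) (i0 i1 : hom A Q) r :
  cof j -> is_cylinder i0 i1 r ->
  exists Q' (i0' i1' : hom B Q') (r' : hom Q' B) (q : hom Q Q'),
    [/\ is_cylinder i0' i1' r', relative_lift j q i0 i1 i0' i1',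
        i0' ∘ j = q ∘ i0 /\ i1' ∘ j = q ∘ i1 & r' ∘ q = j ∘ r].
Proof.
move=> cj [hA hb [w0 w1] [r0 r1]].
have [AA [n0 [n1 hAA]]] := coprod_exists hM hcolim A A.
have [BB [m0 [m1 hBB]]] := coprod_exists hM hcolim B B.
have [jj [jj0 jj1]] := coprod_desc hAA (m0 ∘ j) (m1 ∘ j).
have [ii [ii0 ii1]] := coprod_desc hAA i0 i1.
have [S [s [t hS]]] := pushout_exists jj ii hcolim.
have [sq _] := hS.
have [f [f0 f1]] := coprod_desc hBB (cid B) (cid B).
have [|g [gs gt]] := pushout_desc hS (a := f) (b := j ∘ r).
  apply: (coprod_epi hAA); rewrite -!ccompA ?jj0 ?jj1 ?ii0 ?ii1 ?r0 ?r1.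
    by rewrite ccompA f0 ccomp1l ccomp1r.
  by rewrite ccompA f1 ccomp1l ccomp1r.
have [Q' [c [w [cc fw ww eg]]]] := mc_factor_acyclic_fib g.
have /cofP liftc := cc.
have R0 : w ∘ (c ∘ (s ∘ m0)) = cid B by rewrite !ccompA -eg gs.
have R1 : w ∘ (c ∘ (s ∘ m1)) = cid B by rewrite !ccompA -eg gs.
have rel : relative_lift j (c ∘ t) i0 i1 (c ∘ (s ∘ m0)) (c ∘ (s ∘ m1)).
  move=> X Y p fp wp a0 a1 x b e0 e1 p0 p1 px.
  have [y [y0 y1]] := coprod_desc hBB a0 a1.
  have [|z [z1 z2]] := pushout_desc hS (a := y) (b := x).
    by apply: (coprod_epi hAA); rewrite -!ccompA ?jj0 ?jj1 ?ii0 ?ii1 ccompA ?y0 ?y1.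
  have [|l [l1 l2]] := liftc _ _ _ fp wp z b.
    apply: (pushout_epi hS); rewrite -!ccompA ?z1 ?z2 //.
    by apply: (coprod_epi hBB); rewrite -!ccompA ?y0 ?y1.
  by exists l; split; rewrite // !ccompA l1 ?z1 ?z2.
have q0 : c ∘ (s ∘ m0) ∘ j = c ∘ t ∘ i0.
  by rewrite -!ccompA -jj0 -ii0 !(ccompA s) !(ccompA t) sq.
have q1 : c ∘ (s ∘ m1) ∘ j = c ∘ t ∘ i1.
  by rewrite -!ccompA -jj1 -ii1 !(ccompA s) !(ccompA t) sq.
exists Q', (c ∘ (s ∘ m0)), (c ∘ (s ∘ m1)), w, (c ∘ t); split=> //; last first.
  by rewrite ccompA -eg.
split=> //; first exact (cofibrant_cof hM hA cj).
  move=> X Y p fp wp a0 a1 b e0 e1.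
  (* The problem is first solved on [Q], after restriction along [j], and then extended by [rel]. *)
  have [||x [x0 x1 px]] := hb _ _ _ fp wp (a0 ∘ j) (a1 ∘ j) (b ∘ (c ∘ t)).
  - by rewrite ccompA e0 -ccompA q0 ccompA.
  - by rewrite ccompA e1 -ccompA q1 ccompA.
  have [l [l0 l1 _ pl]] := rel _ _ _ fp wp _ _ _ _ (esym x0) (esym x1) e0 e1 px.
  by exists l.
by split; apply: (mc_two_of_three_r ww); rewrite ?R0 ?R1; apply: weq_id.
Qed.

(** The relative construction for [0 -> A], starting from the constant cylinder on the zero
    object. *)
Lemma cylinder_exists A : cofibrant A ->
  exists Q (i0 i1 : hom A Q) r, is_cylinder i0 i1 r.
Proof.
move=> hA; have hz := zero_obP hM.
have [||Q [i0 [i1 [r [_ [h _ _ _]]]]]] := @cylinder_relative _ A _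
   '0 (cid (zero_ob hM)) (cid (zero_ob hM)) (cid (zero_ob hM)); last by exists Q, i0, i1, r.
- by apply: hA; case: hz.
split; try by split; rewrite ?ccomp1l //; apply: weq_id.
  apply/(cofibrantP hM) => X Y p _ _ b; exists '0.
  exact: from_zero_eq hz.
by move=> X Y p _ _ a0 a1 b _ _; exists '0; split; apply: from_zero_eq hz.
Qed.

(** Lifting problems on [Q''] are lifting problems on [Q'] that vanish on [Q]. The delicate point is
    that [d0] is a weak equivalence: it is a pushout of the acyclic cofibration [m] into [Q'] from
    [Q] and [B] glued along the first end. *)
Lemma cylinder_quotient A B D Q Q' Q'' (j : hom A B) (g : hom B D)
    (i0 i1 : hom A Q) r (i0' i1' : hom B Q') r' (q : hom Q Q') (k : hom Q' Q'')
    (d0 d1 : hom D Q'') :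
  cof j -> is_coker hM j g -> is_cylinder i0 i1 r -> is_cylinder i0' i1' r' ->
  relative_lift j q i0 i1 i0' i1' ->
  i0' ∘ j = q ∘ i0 -> i1' ∘ j = q ∘ i1 -> r' ∘ q = j ∘ r ->
  is_coker hM q k -> d0 ∘ g = k ∘ i0' -> d1 ∘ g = k ∘ i1' ->
  exists r'', is_cylinder d0 d1 r''.
Proof.
move=> cj hg [hA hb [w0 w1] [r0 r1]] [hB hb' [w0' w1'] [r0' r1']] rel q0 q1 rq hk k0 k1.
have liftj X Y (p : hom X Y) : fib p -> weq p -> has_lift j p.
  by move: cj; move/cofP => h fp wp; apply: h.
have [|r'' er] := coker_desc hk (a := g ∘ r').
  by rewrite -ccompA rq ccompA hg.1 zero_comp.
have r0'' : r'' ∘ d0 = cid D.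
  by apply: (coker_epi hg); rewrite -ccompA k0 ccompA er -ccompA r0' ccomp1l ccomp1r.
have r1'' : r'' ∘ d1 = cid D.
  by apply: (coker_epi hg); rewrite -ccompA k1 ccompA er -ccompA r1' ccomp1l ccomp1r.
have wd0 : weq d0.
  have ci0 : cof i0.
    apply/cofP => X Y p fp wp a b e.
    have /(cofibrantP hM) hA' := hA.
    have [x ex] := hA' _ _ _ fp wp (b ∘ i1).
    by have [l [l0 _ pl]] := hb _ _ _ fp wp _ _ _ e ex; exists l.
  have [S [s [t hS]]] := pushout_exists i0 j hcolim.
  have wt : weq t := acyclic_cof_pushout hS ci0 w0.
  have [m [ms mt]] := pushout_desc hS (esym q0).
  have wm : weq m by apply: (mc_two_of_three_l wt); rewrite mt.
  have cm : cof m.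
    apply/cofP => X Y p fp wp a b e.
    (* [rel] needs a value at the second end of [Q']; [x] extends the given one from [A] to [B]
       along [j]. *)
    have [|x [x1 x2]] := liftj _ _ p fp wp (a ∘ s ∘ i1) (b ∘ i1').
      by rewrite !ccompA e -!ccompA (ccompA m) ms q1.
    have [|||||l [l0 l1 lq pl]] :=
      rel _ _ _ fp wp (a ∘ t) x (a ∘ s) b => //.
    - by case: hS => e1 _; rewrite -ccompA -e1 ccompA.
    - by rewrite ccompA e -ccompA mt.
    - by rewrite ccompA e -ccompA ms.
    exists l; split=> //.
    by apply: (pushout_epi hS); rewrite -ccompA ?ms ?mt.
  have /acyclic_cofP liftm := conj cm wm.
  suff [] : cof d0 /\ weq d0 by [].
  apply/acyclic_cofP => X Y p fp a b e.
  have [|x [x1 x2]] := pushout_desc hS (a := '0) (b := a ∘ g).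
    by rewrite zero_comp -ccompA hg.1 comp_zero.
  have [|l [lm pl]] := liftm _ _ _ fp x (b ∘ k).
    apply: (pushout_epi hS); rewrite -!ccompA ?x1 ?x2 ?ms ?mt.
      by rewrite comp_zero hk.1 comp_zero.
    by rewrite ccompA e -ccompA k0.
  have [|y ey] := coker_desc hk (a := l); first by rewrite -ms ccompA lm x1.
  exists y; split; last by apply: (coker_epi hk); rewrite -ccompA ey.
  by apply: (coker_epi hg); rewrite -ccompA k0 ccompA ey -mt ccompA lm x2.
have wr : weq r'' by apply: (mc_two_of_three_l wd0); rewrite r0''; apply: weq_id.
exists r''; split=> //.
- exact: cof_coker_cofibrant cj hg.
- move=> X Y p fp wp a0 a1 b e0 e1.
  have [|||||l [l0 l1 lq pl]] :=
    rel _ _ _ fp wp (a0 ∘ g) (a1 ∘ g) '0 (b ∘ k).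
  - by rewrite zero_comp -ccompA hg.1 comp_zero.
  - by rewrite zero_comp -ccompA hg.1 comp_zero.
  - by rewrite ccompA e0 -!ccompA k0.
  - by rewrite ccompA e1 -!ccompA k1.
  - by rewrite comp_zero -ccompA hk.1 comp_zero.
  have [x ex] := coker_desc hk lq.
  exists x; split; last by apply: (coker_epi hk); rewrite -ccompA ex.
    by apply: (coker_epi hg); rewrite -ccompA k0 ccompA ex.
  by apply: (coker_epi hg); rewrite -ccompA k1 ccompA ex.
- by split=> //; apply: (mc_two_of_three_r wr); rewrite r1''; apply: weq_id.
Qed.

End Cylinders.

(** * Gluing copies of a cylinder *)

Section Circles.
Variables (M : model_category) (hM : pointed M).
Implicit Types A B D Q W Y T E : M.

Local Notation "'0" := (zero_map hM _ _) (at level 0).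
Local Notation hcolim := (@mc_colimits M).

(* [Y] is the quotient of the cylinder [Q] by its two ends. *)
Definition is_circle A Q (i0 i1 : hom A Q) Y (y : hom Q Y) : Prop :=
  [/\ y ∘ i0 = '0, y ∘ i1 = '0
    & forall T (a : hom Q T), a ∘ i0 = '0 -> a ∘ i1 = '0 ->
        exists! u : hom Y T, u ∘ y = a].

(* [W] is the quotient of two consecutive copies of [Q] by the outer ends. *)
Definition is_double A Q (i0 i1 : hom A Q) W (x1 x2 : hom Q W) : Prop :=
  [/\ x1 ∘ i0 = '0, x1 ∘ i1 = x2 ∘ i0, x2 ∘ i1 = '0
    & forall T (a b : hom Q T), a ∘ i0 = '0 -> a ∘ i1 = b ∘ i0 ->
        b ∘ i1 = '0 -> exists! u : hom W T, u ∘ x1 = a /\ u ∘ x2 = b].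

(* [E] is two consecutive copies of [Q] glued to a third copy along the ends. *)
Definition is_theta A Q (i0 i1 : hom A Q) E (t1 t2 t3 : hom Q E) : Prop :=
  [/\ t1 ∘ i0 = t3 ∘ i0, t1 ∘ i1 = t2 ∘ i0, t2 ∘ i1 = t3 ∘ i1
    & forall T (a b c : hom Q T), a ∘ i0 = c ∘ i0 -> a ∘ i1 = b ∘ i0 ->
        b ∘ i1 = c ∘ i1 ->
        exists! u : hom E T, [/\ u ∘ t1 = a, u ∘ t2 = b & u ∘ t3 = c]].

Section Universal.
Variables (A Q : M) (i0 i1 : hom A Q).

Lemma circle_desc Y (y : hom Q Y) : is_circle i0 i1 y ->
  forall T (a : hom Q T), a ∘ i0 = '0 -> a ∘ i1 = '0 ->
    exists u : hom Y T, u ∘ y = a.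
Proof. by move=> [_ _ h] T a e0 e1; have [u [e _]] := h T a e0 e1; exists u. Qed.

Lemma circle_epi Y (y : hom Q Y) : is_circle i0 i1 y ->
  forall T (u v : hom Y T), u ∘ y = v ∘ y -> u = v.
Proof.
move=> [y0 y1 h] T u v e; have [||w [_ hw]] := h T (u ∘ y).
- by rewrite -ccompA y0 comp_zero.
- by rewrite -ccompA y1 comp_zero.
by rewrite -(hw u) // -(hw v).
Qed.

Lemma double_desc W (x1 x2 : hom Q W) : is_double i0 i1 x1 x2 ->
  forall T (a b : hom Q T), a ∘ i0 = '0 -> a ∘ i1 = b ∘ i0 -> b ∘ i1 = '0 ->
    exists u : hom W T, u ∘ x1 = a /\ u ∘ x2 = b.
Proof.
by move=> [_ _ _ h] T a b e0 e e1; have [u [? _]] := h T a b e0 e e1; exists u.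
Qed.

Lemma double_epi W (x1 x2 : hom Q W) : is_double i0 i1 x1 x2 ->
  forall T (u v : hom W T), u ∘ x1 = v ∘ x1 -> u ∘ x2 = v ∘ x2 -> u = v.
Proof.
move=> [x0 x x3 h] T u v e1 e2; have [|||w [_ hw]] := h T (u ∘ x1) (u ∘ x2).
- by rewrite -ccompA x0 comp_zero.
- by rewrite -!ccompA x.
- by rewrite -ccompA x3 comp_zero.
by rewrite -(hw u) // -(hw v).
Qed.

Lemma theta_desc E (t1 t2 t3 : hom Q E) : is_theta i0 i1 t1 t2 t3 ->
  forall T (a b c : hom Q T), a ∘ i0 = c ∘ i0 -> a ∘ i1 = b ∘ i0 ->
    b ∘ i1 = c ∘ i1 ->
    exists u : hom E T, [/\ u ∘ t1 = a, u ∘ t2 = b & u ∘ t3 = c].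
Proof.
move=> [_ _ _ h] T a b c e0 e e1.
by have [u [? _]] := h T a b c e0 e e1; exists u.
Qed.

Lemma theta_epi E (t1 t2 t3 : hom Q E) : is_theta i0 i1 t1 t2 t3 ->
  forall T (u v : hom E T),
    u ∘ t1 = v ∘ t1 -> u ∘ t2 = v ∘ t2 -> u ∘ t3 = v ∘ t3 -> u = v.
Proof.
move=> [e0 e e1 h] T u v f1 f2 f3.
have [|||w [_ hw]] := h T (u ∘ t1) (u ∘ t2) (u ∘ t3); rewrite -?ccompA ?e0 ?e ?e1 //.
by rewrite -(hw u) // -(hw v).
Qed.

Lemma circle_exists : exists Y (y : hom Q Y), is_circle i0 i1 y.
Proof.
have [C [k hk]] := coker_exists hM hcolim i1.
have [Y [y hy]] := coker_exists hM hcolim (k ∘ i0).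
exists Y, (y ∘ k); split; [by rewrite -ccompA hy.1|by rewrite -ccompA hk.1 comp_zero|].
move=> T a e0 e1; have [u eu] := coker_desc hk e1.
have [|v ev] := coker_desc hy (a := u); first by rewrite ccompA eu.
exists v; split; first by rewrite ccompA ev.
move=> v' ev'; apply: (coker_epi hy); apply: (coker_epi hk).
by rewrite -!ccompA ev' ccompA ev.
Qed.

(** Both start from [Z], two copies of [Q] glued end to end, with outer ends [f]: [W] is the
    cokernel of [f], and [E] the pushout of [f] with the ends [g] of a third copy. *)
Lemma double_theta_exist :
  (exists W (x1 x2 : hom Q W), is_double i0 i1 x1 x2) /\
  exists E (t1 t2 t3 : hom Q E), is_theta i0 i1 t1 t2 t3.
Proof.
have [Z [z1 [z2 hZ]]] := pushout_exists i1 i0 hcolim.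
have [zz _] := hZ.
have [AA [n0 [n1 hAA]]] := coprod_exists hM hcolim A A.
have [f [f0 f1]] := coprod_desc hAA (z1 ∘ i0) (z2 ∘ i1).
split.
  have [W [w hw]] := coker_exists hM hcolim f.
  have w0 : w ∘ z1 ∘ i0 = '0 by rewrite -ccompA -f0 ccompA hw.1 zero_comp.
  have w1 : w ∘ z2 ∘ i1 = '0 by rewrite -ccompA -f1 ccompA hw.1 zero_comp.
  exists W, (w ∘ z1), (w ∘ z2); split=> //; first by rewrite -!ccompA zz.
  move=> T a b e0 e e1; have [u [u1 u2]] := pushout_desc hZ e.
  have [|v ev] := coker_desc hw (a := u).
    by apply: (coprod_epi hAA); rewrite -ccompA ?f0 ?f1 zero_comp ccompA ?u1 ?u2.
  exists v; split; first by rewrite !ccompA ev.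
  move=> v' [e3 e4]; apply: (coker_epi hw); apply: (pushout_epi hZ).
    by rewrite -!ccompA e3 ccompA ev.
  by rewrite -!ccompA e4 ccompA ev.
have [g [g0 g1]] := coprod_desc hAA i0 i1.
have [E [s [t hE]]] := pushout_exists f g hcolim.
have [ee _] := hE.
have s0 : s ∘ z1 ∘ i0 = t ∘ i0 by rewrite -ccompA -f0 -g0 !ccompA ee.
have s1 : s ∘ z2 ∘ i1 = t ∘ i1 by rewrite -ccompA -f1 -g1 !ccompA ee.
exists E, (s ∘ z1), (s ∘ z2), t; split=> //; first by rewrite -!ccompA zz.
move=> T a b c e0 e e1; have [u [u1 u2]] := pushout_desc hZ e.
have [|v [vs vt]] := pushout_desc hE (a := u) (b := c).
  by apply: (coprod_epi hAA); rewrite -!ccompA ?f0 ?f1 ?g0 ?g1 ccompA ?u1 ?u2.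
exists v; split; first by rewrite !ccompA vs.
move=> v' [e3 e4 e5]; apply: (pushout_epi hE); last by rewrite vt e5.
by apply: (pushout_epi hZ); rewrite -!ccompA ?e3 ?e4 ccompA vs ?u1 ?u2.
Qed.

End Universal.

Section OneCylinder.
Variables (A Q : M) (i0 i1 : hom A Q) (r : hom Q A).
Hypothesis hQ : is_cylinder i0 i1 r.

Lemma cylinder_cof1 : cof i1.
Proof.
have [/(cofibrantP hM) hA hb _ _] := hQ.
apply/cofP => X Y p fp wp a b e.
have [x ex] := hA _ _ _ fp wp (b ∘ i0).
by have [l [_ l1 pl]] := hb _ _ _ fp wp _ _ _ ex e; exists l.
Qed.

Section Cone.
Variables (C : M) (k : hom Q C).
Hypothesis hk : is_coker hM i1 k.

Lemma cylinder_cone_cofibrant : cofibrant C.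
Proof. exact: (cof_coker_cofibrant cylinder_cof1 hk). Qed.

Lemma cylinder_cone_cof : cof (k ∘ i0).
Proof.
have [_ hb _ _] := hQ; apply/cofP => X Y p fp wp a b e.
have [||l [l0 l1 pl]] := hb _ _ _ fp wp a '0 (b ∘ k).
- by rewrite e ccompA.
- by rewrite comp_zero -ccompA hk.1 comp_zero.
have [u eu] := coker_desc hk l1; exists u; split; first by rewrite ccompA eu.
by apply: (coker_epi hk); rewrite -ccompA eu.
Qed.

(** The map [0 -> C] is a pushout of the acyclic cofibration [i1]. *)
Lemma cylinder_cone_contractible : contractible C.
Proof.
have [_ _ [_ w1] _] := hQ.
apply: (@weq_contractible _ hM _ _ '0 (zero_obP hM)).
suff [] : cof (zero_map hM (zero_ob hM) C) /\ weq (zero_map hM (zero_ob hM) C) by [].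
apply/acyclic_cofP => X Y p fp a b _.
have /acyclic_cofP lift1 := conj cylinder_cof1 w1.
have [|l [l1 pl]] := lift1 _ _ _ fp '0 (b ∘ k).
  by rewrite comp_zero -ccompA hk.1 comp_zero.
have [u eu] := coker_desc hk l1; exists u.
split; first exact: from_zero_eq (zero_obP hM).
by apply: (coker_epi hk); rewrite -ccompA eu.
Qed.

(** Collapsing the ends one after the other presents the circle as the quotient of the cone [C] by
    [A], hence as a model of the suspension of [A]. *)
Lemma cylinder_cone_circle Y (y : hom Q Y) (y' : hom C Y) :
  is_circle i0 i1 y -> y' ∘ k = y -> is_coker hM (k ∘ i0) y'.
Proof.
move=> hy e; split=> [|T a ea]; first by rewrite ccompA e; case: hy.
have [||u eu] := circle_desc hy (a := a ∘ k); rewrite -?ccompA //.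
  by rewrite hk.1 comp_zero.
exists u; split; first by apply: (coker_epi hk); rewrite -ccompA e.
move=> v ev; apply: (circle_epi hy).
by rewrite eu -ev -e ccompA.
Qed.

End Cone.

Lemma circle_cofibrant Y (y : hom Q Y) : is_circle i0 i1 y -> cofibrant Y.
Proof.
move=> hy; have [_ y1 _] := hy.
have [C [k hk]] := coker_exists hM hcolim i1.
have [y' ey] := coker_desc hk y1.
exact: (cof_coker_cofibrant (cylinder_cone_cof hk) (cylinder_cone_circle hk hy ey)).
Qed.

(** Collapsing the second copy of [Q] amounts to dividing [W] by the contractible cone [C] of that
    copy, embedded by the cofibration [z]; then [cone_quotient_weq] applies. *)
Lemma double_collapse Y (y : hom Q Y) W (x1 x2 : hom Q W) (u : hom W Y) :
  is_circle i0 i1 y -> is_double i0 i1 x1 x2 ->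
  u ∘ x1 = y -> u ∘ x2 = '0 -> cofibrant W /\ weq u.
Proof.
move=> hy hx u1 u2; have [y0 y1 _] := hy; have [xa xb xc _] := hx.
have [_ hb _ _] := hQ.
have [C [k hk]] := coker_exists hM hcolim i1.
have [z ez] := coker_desc hk xc.
have cz : cof z.
  (* Extending from the cone to [W] is a lifting problem on the first copy of [Q], with zero at the
     outer end and the given value at the inner one. *)
  apply/cofP => X T p fp wp a b e.
  have [||l [l0 l1 pl]] := hb _ _ _ fp wp '0 (a ∘ k ∘ i0) (b ∘ x1).
  - by rewrite comp_zero -ccompA xa comp_zero.
  - by rewrite !ccompA e -[RHS]ccompA xb -ez !ccompA.
  have [||v [v1 v2]] := double_desc hx l0 (b := a ∘ k) => //.
    by rewrite -ccompA hk.1 comp_zero.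
  exists v; split; first by apply: (coker_epi hk); rewrite -ccompA ez.
  apply: (double_epi hx); first by rewrite -ccompA v1.
  by rewrite -ccompA v2 ccompA e -ccompA ez.
have hC := cylinder_cone_cofibrant hk.
have hu : is_coker hM z u.
  split=> [|T a ea].
    by apply: (coker_epi hk); rewrite -ccompA ez u2 zero_comp.
  have ax2 : a ∘ x2 = '0 by rewrite -ez ccompA ea zero_comp.
  have [||v ev] := circle_desc hy (a := a ∘ x1).
  - by rewrite -ccompA xa comp_zero.
  - by rewrite -ccompA xb ccompA ax2 zero_comp.
  exists v; split.
    apply: (double_epi hx); first by rewrite -ccompA u1.
    by rewrite -ccompA u2 comp_zero.
  by move=> v' ev'; apply: (circle_epi hy); rewrite ev -ev' -ccompA u1.
split; first exact (cofibrant_cof hM hC cz).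
exact: (cone_quotient_weq hC (cylinder_cone_contractible hk) cz hu).
Qed.

(** A lift over the first two edges first chooses a value [m] at their common end, by cofibrancy of
    [A], and then fills each edge. *)
Lemma theta_cof E (t1 t2 t3 : hom Q E) : is_theta i0 i1 t1 t2 t3 -> cof t3.
Proof.
have [/(cofibrantP hM) hA hb _ _] := hQ.
move=> ht; have [e0 e e1 _] := ht.
apply/cofP => X Y p fp wp a b ea.
have [m em] := hA _ _ _ fp wp (b ∘ t1 ∘ i1).
have [||l1 [l10 l11 pl1]] := hb _ _ _ fp wp (a ∘ i0) m (b ∘ t1) => //.
  by rewrite ccompA ea -!ccompA e0.
have [||l2 [l20 l21 pl2]] := hb _ _ _ fp wp m (a ∘ i1) (b ∘ t2).
- by rewrite em -!ccompA e.
- by rewrite ccompA ea -!ccompA e1.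
have [|||u [u1 u2 u3]] := theta_desc ht (a := l1) (b := l2) (c := a) => //.
  by rewrite l11 l20.
by exists u; split=> //; apply: (theta_epi ht); rewrite -ccompA ?u1 ?u2 ?u3.
Qed.

Lemma theta_double_coker E (t1 t2 t3 : hom Q E) W (x1 x2 : hom Q W)
    (e : hom E W) :
  is_theta i0 i1 t1 t2 t3 -> is_double i0 i1 x1 x2 ->
  e ∘ t1 = x1 -> e ∘ t2 = x2 -> e ∘ t3 = '0 -> is_coker hM t3 e.
Proof.
move=> ht hx e1 e2 e3; split=> // T a ea; have [f0 f f1 _] := ht.
have [|||u [u1 u2]] := double_desc hx (a := a ∘ t1) (b := a ∘ t2).
- by rewrite -ccompA f0 ccompA ea zero_comp.
- by rewrite -!ccompA f.
- by rewrite -ccompA f1 ccompA ea zero_comp.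
exists u; split; first by apply: (theta_epi ht); rewrite -ccompA ?e1 ?e2 ?e3 ?comp_zero.
by move=> v ev; apply: (double_epi hx); rewrite ?u1 ?u2 -ev -ccompA ?e1 ?e2.
Qed.

End OneCylinder.

Section Relative.
Variables (A B D Q Q' Q'' : M) (j : hom A B) (g : hom B D).
Variables (q : hom Q Q') (k : hom Q' Q'').
Variables (i0 i1 : hom A Q) (i0' i1' : hom B Q') (d0 d1 : hom D Q'').
Hypotheses (cj : cof j) (hg : is_coker hM j g) (hk : is_coker hM q k).
Hypothesis rel : relative_lift j q i0 i1 i0' i1'.
Hypotheses (q0 : i0' ∘ j = q ∘ i0) (q1 : i1' ∘ j = q ∘ i1).
Hypotheses (k0 : d0 ∘ g = k ∘ i0') (k1 : d1 ∘ g = k ∘ i1').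

(** Forming circles preserves cofiber sequences: a lift for [f] is a relative lift with both ends
    zero, and quotients commute with each other. *)
Lemma circle_relative Y Y' Y'' (y : hom Q Y) (y' : hom Q' Y') (y'' : hom Q'' Y'')
    (f : hom Y Y') (h : hom Y' Y'') :
  is_circle i0 i1 y -> is_circle i0' i1' y' -> is_circle d0 d1 y'' ->
  f ∘ y = y' ∘ q -> h ∘ y' = y'' ∘ k -> cof f /\ is_coker hM f h.
Proof.
move=> hy hy' hy'' ef eh.
have [y0 y1 _] := hy; have [y0' y1' _] := hy'.
split.
  apply/cofP => X T p fp wp a b e.
  have [|||||l [l0 l1 lq pl]] := rel fp wp (a0 := '0) (a1 := '0) (c := a ∘ y)
      (b := b ∘ y'); rewrite -?ccompA ?y0 ?y1 ?y0' ?y1' ?comp_zero ?zero_comp //.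
    by rewrite ccompA e -ccompA ef.
  have [v ev] := circle_desc hy' l0 l1; exists v; split.
    by apply: (circle_epi hy); rewrite -ccompA ef ccompA ev lq.
  by apply: (circle_epi hy'); rewrite -ccompA ev pl.
split=> [|T a ea].
  by apply: (circle_epi hy); rewrite -ccompA ef ccompA eh -ccompA hk.1 comp_zero zero_comp.
have [|u eu] := coker_desc hk (a := a ∘ y').
  by rewrite -ccompA -ef ccompA ea zero_comp.
have [||v ev] := circle_desc hy'' (a := u).
- by apply: (coker_epi hg); rewrite -ccompA k0 ccompA eu -ccompA y0' comp_zero zero_comp.
- by apply: (coker_epi hg); rewrite -ccompA k1 ccompA eu -ccompA y1' comp_zero zero_comp.
exists v; split; first by apply: (circle_epi hy'); rewrite -ccompA eh ccompA ev.
move=> v' ev'; apply: (circle_epi hy''); apply: (coker_epi hk).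
by rewrite ev eu -ccompA -eh ccompA ev'.
Qed.

Lemma double_relative W W' W'' (x1 x2 : hom Q W) (x1' x2' : hom Q' W')
    (x1'' x2'' : hom Q'' W'') (f : hom W W') (h : hom W' W'') :
  is_double i0 i1 x1 x2 -> is_double i0' i1' x1' x2' ->
  is_double d0 d1 x1'' x2'' ->
  f ∘ x1 = x1' ∘ q -> f ∘ x2 = x2' ∘ q ->
  h ∘ x1' = x1'' ∘ k -> h ∘ x2' = x2'' ∘ k -> cof f /\ is_coker hM f h.
Proof.
move=> hx hx' hx'' f1 f2 h1 h2.
have [xa xb xc _] := hx; have [xa' xb' xc' _] := hx'.
split.
  apply/cofP => X T p fp wp a b e.
  have /cofP liftj := cj.
  (* The value on the middle copy of [B] is fixed first, by extension along [j]; the two copies of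
     [Q'] can then be treated separately. *)
  have [|m [mj pm]] := liftj _ _ _ fp wp (a ∘ x1 ∘ i1) (b ∘ x1' ∘ i1').
    by rewrite !ccompA e -(ccompA _ _ j) q1 -(ccompA b f) f1 !ccompA.
  have [|||||l [l0 l1 lq pl]] := rel fp wp (a0 := '0) (a1 := m) (c := a ∘ x1)
      (b := b ∘ x1'); rewrite -?ccompA ?xa ?xa' ?comp_zero ?zero_comp //.
  - by rewrite mj -ccompA.
  - by rewrite pm -ccompA.
  - by rewrite ccompA e -ccompA f1.
  have [|||||l' [l0' l1' lq' pl']] := rel fp wp (a0 := m) (a1 := '0) (c := a ∘ x2)
      (b := b ∘ x2'); rewrite -?ccompA ?xc ?xc' ?comp_zero ?zero_comp //.
  - by rewrite mj -ccompA xb.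
  - by rewrite pm -ccompA xb'.
  - by rewrite ccompA e -ccompA f2.
  have [||v [v1 v2]] := double_desc hx' l0 (b := l') => //; first by rewrite l1 l0'.
  exists v; split.
    by apply: (double_epi hx); rewrite -ccompA ?f1 ?f2 ccompA ?v1 ?v2 ?lq ?lq'.
  by apply: (double_epi hx'); rewrite -ccompA ?v1 ?v2 ?pl ?pl'.
split=> [|T a ea].
  apply: (double_epi hx); rewrite -ccompA ?f1 ?f2 ccompA ?h1 ?h2 -ccompA hk.1;
    by rewrite comp_zero zero_comp.
have [|u1 eu1] := coker_desc hk (a := a ∘ x1').
  by rewrite -ccompA -f1 ccompA ea zero_comp.
have [|u2 eu2] := coker_desc hk (a := a ∘ x2').
  by rewrite -ccompA -f2 ccompA ea zero_comp.
have [|||v [v1 v2]] := double_desc hx'' (a := u1) (b := u2).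
- by apply: (coker_epi hg); rewrite -ccompA k0 ccompA eu1 -ccompA xa' comp_zero zero_comp.
- by apply: (coker_epi hg); rewrite -!ccompA k1 k0 !ccompA eu1 eu2 -!ccompA xb'.
- by apply: (coker_epi hg); rewrite -ccompA k1 ccompA eu2 -ccompA xc' comp_zero zero_comp.
exists v; split.
  by apply: (double_epi hx'); rewrite -ccompA ?h1 ?h2 ccompA ?v1 ?v2.
move=> v' ev'; apply: (double_epi hx''); apply: (coker_epi hk).
  by rewrite v1 eu1 -ccompA -h1 ccompA ev'.
by rewrite v2 eu2 -ccompA -h2 ccompA ev'.
Qed.

End Relative.
End Circles.

(** * Triangulated categories *)

Section Preadditive.
Variables (C : category) (P : preadditive C).
Implicit Types X Y Z : C.

Local Notation "f ⊕ g" := (hadd P f g) (at level 50, left associativity).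
Local Notation "'0" := (hzero P _ _) (at level 0).

Lemma hadd0r X Y (f : hom X Y) : f ⊕ '0 = f.
Proof. by rewrite haddC hadd0. Qed.

Lemma haddNr X Y (f : hom X Y) : f ⊕ hopp P f = '0.
Proof. by rewrite haddC haddN. Qed.

Lemma hadd_cancel_r X Y (h f g : hom X Y) : f ⊕ h = g ⊕ h -> f = g.
Proof.
move/(congr1 (fun u => u ⊕ hopp P h)).
by rewrite -!haddA haddNr !hadd0r.
Qed.

Lemma hadd_cancel_l X Y (h f g : hom X Y) : h ⊕ f = h ⊕ g -> f = g.
Proof. by rewrite ![h ⊕ _]haddC; apply: hadd_cancel_r. Qed.

Lemma hcomp0 X Y Z (g : hom Y Z) : g ∘ hzero P X Y = '0.
Proof. by apply: (@hadd_cancel_r _ _ (g ∘ '0)); rewrite -ccompDr !hadd0. Qed.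

Lemma h0comp X Y Z (f : hom X Y) : hzero P Y Z ∘ f = '0.
Proof. by apply: (@hadd_cancel_r _ _ ('0 ∘ f)); rewrite -ccompDl !hadd0. Qed.

Lemma hcompN X Y Z (g : hom Y Z) (f : hom X Y) :
  g ∘ hopp P f = hopp P (g ∘ f).
Proof. by apply: (@hadd_cancel_r _ _ (g ∘ f)); rewrite -ccompDr !haddN hcomp0. Qed.

Lemma hNcomp X Y Z (g : hom Y Z) (f : hom X Y) :
  hopp P g ∘ f = hopp P (g ∘ f).
Proof. by apply: (@hadd_cancel_r _ _ (g ∘ f)); rewrite -ccompDl !haddN h0comp. Qed.

Lemma hoppK X Y (f : hom X Y) : hopp P (hopp P f) = f.
Proof. by apply: (@hadd_cancel_r _ _ (hopp P f)); rewrite haddN haddNr. Qed.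

Lemma hopp0 X Y : hopp P (hzero P X Y) = '0.
Proof. by rewrite -[LHS]hadd0r haddN. Qed.

Lemma hsub_eq0 X Y (f g : hom X Y) : f ⊕ hopp P g = '0 -> f = g.
Proof. by move=> e; apply: (@hadd_cancel_r _ _ (hopp P g)); rewrite haddNr. Qed.

Lemma is_zero_cid0 X : is_zero X -> cid X = '0.
Proof. by case=> h _; have [m hm] := h X; rewrite (hm (cid X)) [RHS]hm. Qed.

Lemma cid0_is_zero X : cid X = '0 -> is_zero X.
Proof.
move=> e; split=> Y; exists '0 => f; first by rewrite -(ccomp1r f) e hcomp0.
by rewrite -(ccomp1l f) e h0comp.
Qed.

Lemma from_zero X Y (f : hom X Y) : is_zero X -> f = '0.
Proof. by move/is_zero_cid0=> e; rewrite -(ccomp1r f) e hcomp0. Qed.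

End Preadditive.

Lemma additive_functor0 (C D : category) (P : preadditive C) (R : preadditive D)
    (F : functor C D) (X Y : C) :
  additive_functor P R F -> fmap F (hzero P X Y) = hzero R (F X) (F Y).
Proof.
move=> h; apply: (@hadd_cancel_r _ R _ _ (fmap F (hzero P X Y))).
by rewrite -h !hadd0.
Qed.

Lemma additive_functorN (C D : category) (P : preadditive C) (R : preadditive D)
    (F : functor C D) (X Y : C) (f : hom X Y) :
  additive_functor P R F -> fmap F (hopp P f) = hopp R (fmap F f).
Proof.
move=> h; apply: (@hadd_cancel_r _ R _ _ (fmap F f)).
by rewrite -h !haddN (additive_functor0 _ _ h).
Qed.

Lemma additive_functor_zero_ob (C D : category) (P : preadditive C)
    (R : preadditive D) (F : functor C D) (X : C) :
  additive_functor P R F -> is_zero X -> is_zero (F X).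
Proof.
move=> h /(is_zero_cid0 P) e; apply: (@cid0_is_zero _ R).
by rewrite -fmap1 e (additive_functor0 _ _ h).
Qed.

Lemma is_iso_left_right (C : category) (X Y : C) (f : hom X Y) (g g' : hom Y X) :
  g ∘ f = cid X -> f ∘ g' = cid Y -> is_iso f.
Proof.
move=> e e'; exists g; split=> //.
suff -> : g = g' by [].
by rewrite -(ccomp1r g) -e' ccompA e ccomp1l.
Qed.

Section Triangles.
Variables (T : triangle_data) (hT : is_triangulated T).
Implicit Types X Y Z W : T.

Local Notation S := (tshift T).
Local Notation "f ⊕ g" := (hadd (tadd T) f g) (at level 50, left associativity).
Local Notation "⊖ f" := (hopp (tadd T) f) (at level 35).
Local Notation "'0" := (hzero (tadd T) _ _) (at level 0).

Lemma shift_full X Y (u : hom (S X) (S Y)) : exists f, fmap S f = u.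
Proof. exact: equivalence_full (tr_shift_equiv hT). Qed.

Lemma shift_faithful X Y (f g : hom X Y) : fmap S f = fmap S g -> f = g.
Proof. exact: equivalence_faithful (tr_shift_equiv hT). Qed.

Lemma shift0 X Y : fmap S (hzero (tadd T) X Y) = '0.
Proof. exact: additive_functor0 (tr_shift_additive hT). Qed.

Lemma triangle_rotate X Y Z (f : hom X Y) (g : hom Y Z) (h : hom Z (S X)) :
  texact f g h -> texact g h (⊖ fmap S f).
Proof. by move/(tr_rotate hT). Qed.

(** A filler from the triangle [(1, 0, 0)] of [X], whose third object is zero, forces the composite
    to vanish. *)
Lemma triangle_comp X Y Z (f : hom X Y) (g : hom Y Z) (h : hom Z (S X)) :
  texact f g h -> g ∘ f = '0.
Proof.
have [[O hO] _] := tr_additive hT.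
move=> e; have [//|c [ec _]] := tr_fill hT (a := cid X) (b := f) (tr_id hT X hO) e.
by rewrite ec hcomp0.
Qed.

Lemma triangle_coexact X Y Z (f : hom X Y) (g : hom Y Z) (h : hom Z (S X))
    W (u : hom Y W) :
  texact f g h -> u ∘ f = '0 -> exists v, v ∘ g = u.
Proof.
have [[O hO] _] := tr_additive hT => e eu.
have hSO := additive_functor_zero_ob (tr_shift_additive hT) hO.
(* The identity triangle of [W], rotated backwards: a filler into it is the desired
   factorization. *)
have e0 : texact (hzero (tadd T) O W) (cid W) (hzero (tadd T) W (S O)).
  apply/(tr_rotate hT); have := tr_id hT W hSO.
  by congr texact; apply: (from_zero_eq _ _ hSO).
have [|c [ec _]] := tr_fill hT (a := hzero (tadd T) X O) (b := u) e e0.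
  by rewrite hcomp0 eu.
by exists c; rewrite -ec ccomp1l.
Qed.

Lemma triangle_exact X Y Z (f : hom X Y) (g : hom Y Z) (h : hom Z (S X))
    W (u : hom W Y) :
  texact f g h -> g ∘ u = '0 -> exists v, f ∘ v = u.
Proof.
have [[O hO] _] := tr_additive hT => e eu.
(* Mapping the rotated identity triangle of [W] to the rotated given one yields a filler between
   suspensions, which [shift_full] desuspends. *)
have e0 := triangle_rotate (tr_id hT W hO).
have [|c [_ ec]] := tr_fill hT (a := u) (b := hzero (tadd T) O Z) e0
  (triangle_rotate e); first by rewrite hcomp0 eu.
have [v ev] := shift_full c; exists v; apply: shift_faithful.
by rewrite fmapM ev -[RHS]ccomp1r -fmap1 -[LHS](hoppK (tadd T)) -hNcomp ec
   hcompN hoppK.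
Qed.

(* [e - 1] has square zero. *)
Lemma triangle_endo_iso X Y Z (f : hom X Y) (g : hom Y Z) (h : hom Z (S X))
    (e : hom Z Z) :
  texact f g h -> e ∘ g = g -> h ∘ e = h -> is_iso e.
Proof.
move=> tri eg he; pose n := e ⊕ ⊖ cid Z.
have ng : n ∘ g = '0 by rewrite ccompDl eg hNcomp ccomp1l haddNr.
have hn : h ∘ n = '0 by rewrite ccompDr he hcompN ccomp1r haddNr.
have [v ev] := triangle_coexact (triangle_rotate tri) ng.
have nn : n ∘ n = '0 by rewrite -{1}ev -ccompA hn hcomp0.
have en : e = cid Z ⊕ n by rewrite haddC /n -haddA haddN hadd0r.
clearbody n; exists (cid Z ⊕ ⊖ n); rewrite en !ccompDl !ccompDr !hNcomp !hcompN.
rewrite nn !ccomp1l !ccomp1r hopp0 !hadd0r -!haddA.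
by rewrite haddNr haddN hadd0r.
Qed.

(** A form of the five lemma: fillers in both directions compose to endomorphisms that
    [triangle_endo_iso] makes invertible, so [c] has a left and a right inverse. *)
Lemma triangle_iso_third X Y Z (f : hom X Y) (g : hom Y Z) (h : hom Z (S X))
    X' Y' Z' (f' : hom X' Y') (g' : hom Y' Z') (h' : hom Z' (S X'))
    (a : hom X X') (b : hom Y Y') :
  texact f g h -> texact f' g' h' -> is_iso a -> is_iso b -> f' ∘ a = b ∘ f ->
  exists c : hom Z Z', [/\ is_iso c, g' ∘ b = c ∘ g & h' ∘ c = fmap S a ∘ h].
Proof.
move=> tri tri' [a' [aa aa']] [b' [bb bb']] e.
have [c [c1 c2]] := tr_fill hT tri tri' e.
have [|c' [c'1 c'2]] := tr_fill hT (a := a') (b := b') tri' tri.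
  rewrite -[LHS]ccomp1l -bb -ccompA (ccompA b) -e -!ccompA aa' ccomp1r.
  by [].
exists c; split=> //.
have [x [x1 _]] : is_iso (c' ∘ c).
  apply: (triangle_endo_iso tri).
    by rewrite -ccompA -c1 ccompA -c'1 -ccompA bb ccomp1r.
  by rewrite ccompA c'2 -ccompA c2 ccompA -fmapM aa fmap1 ccomp1l.
have [y [_ y2]] : is_iso (c ∘ c').
  apply: (triangle_endo_iso tri').
    by rewrite -ccompA -c'1 ccompA -c1 -ccompA bb' ccomp1r.
  by rewrite ccompA c2 -ccompA c'2 ccompA -fmapM aa' fmap1 ccomp1l.
by apply: (@is_iso_left_right _ _ _ c (x ∘ c') (c' ∘ y)); rewrite -?ccompA // ccompA.
Qed.

(** Rotation gives [fmap S f ∘ h = '0], and [fmap S r] cancels [fmap S f]. *)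
Lemma triangle_split_mono X Y Z (f : hom X Y) (g : hom Y Z) (h : hom Z (S X))
    (r : hom Y X) : texact f g h -> r ∘ f = cid X -> h = '0.
Proof.
move=> tri rf.
have := triangle_comp (triangle_rotate (triangle_rotate tri)).
rewrite hNcomp => /(congr1 (fun u => ⊖ u)); rewrite hoppK hopp0.
move/(congr1 (fun u => fmap S r ∘ u)).
by rewrite ccompA -fmapM rf fmap1 ccomp1l hcomp0.
Qed.

Lemma triangle_cid_zero X Z (g : hom X Z) (h : hom Z (S X)) :
  texact (cid X) g h -> is_zero Z.
Proof.
move=> tri; apply: (@cid0_is_zero _ (tadd T)).
have h0 := triangle_split_mono tri (ccomp1l (cid X)).
have g0 := triangle_comp tri; rewrite ccomp1r in g0.
have [|v <-] := @triangle_exact _ _ _ _ _ _ _ (cid Z) (triangle_rotate tri).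
  by rewrite h0 h0comp.
by rewrite g0 h0comp.
Qed.

(* The hypotheses say that twice the identity of the triangle [(2, 2, 2 w)] is
   a composite of a map of triangles that is the identity on the third object
   and one that is the identity on the first. *)
Lemma no_double_of_two X (w : hom X (S X)) P (s : hom X P) (t p' : hom P X)
    (p : hom X P) (h : hom X (S X)) :
  let two := cid X ⊕ cid X in
  is_iso w -> two <> '0 -> two ⊕ two = '0 ->
  (forall e : hom X X, e = '0 \/ e = cid X \/ e = two \/ e = ⊖ cid X) ->
  texact two two (w ∘ two) -> texact s t h ->
  p ∘ two = s ∘ two -> t ∘ p = two -> p' ∘ s = two -> two ∘ p' = two ∘ t ->
  p' ∘ p = two -> False.
Proof.
move=> two [w' [w'w ww']] two0 four0 hend tri2 tri p2 tp bs b2 bp.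
have twol Y (f : hom Y X) : two ∘ f = f ⊕ f by rewrite ccompDl ccomp1l.
have twor Y (f : hom X Y) : f ∘ two = f ⊕ f by rewrite ccompDr ccomp1r.
have ht : h ∘ t = '0 := triangle_comp (triangle_rotate tri).
have t0 : t <> '0 by move=> e; apply: two0; rewrite -tp e h0comp.
(* The connecting map is [w ∘ n] with [n] among [0], [1], [2], [-1], and [n ∘ t] vanishes because
   [h ∘ t] does. *)
have [n en] : exists n, h = w ∘ n.
  by exists (w' ∘ h); rewrite ccompA ww' ccomp1l.
have nt : n ∘ t = '0.
  by rewrite -[LHS]ccomp1l -w'w -ccompA (ccompA w) -en ht hcomp0.
case: (hend n) => [|[|[|]]] n0; last first.
- rewrite n0 hNcomp ccomp1l in nt.
  by apply: t0; rewrite -(hoppK (tadd T) t) nt hopp0.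
(* [n = 2]: exactness gives [t = 2 t'], so [2 = t p = t' (p 2) = t' s 2 = t s = 0]. *)
- rewrite n0 in nt.
  have [t' et'] := triangle_exact tri2 nt.
  apply: two0; rewrite -tp -et'.
  have -> : two ∘ t' ∘ p = t' ∘ (p ∘ two) by rewrite twor ccompDr -ccompA twol.
  rewrite p2 ccompA.
  have -> : t' ∘ s ∘ two = two ∘ t' ∘ s by rewrite twor -ccompA twol.
  by rewrite et' (triangle_comp tri).
- by apply: t0; rewrite -(ccomp1l t) -n0 nt.
(* [n = 0]: the triangle splits, [v] is a section of [t], and [p = v 2 + s x] for some [x]. *)
rewrite n0 hcomp0 in en.
have [|v tv] := @triangle_exact _ _ _ _ _ _ _ (cid X) (triangle_rotate tri).
  by rewrite en h0comp.
have [|x ex] := @triangle_exact _ _ _ _ _ _ _ (p ⊕ ⊖ (v ∘ two)) tri.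
  by rewrite ccompDr hcompN ccompA tv ccomp1l tp haddNr.
have {ex} ex : p = v ∘ two ⊕ s ∘ x.
  by rewrite ex [RHS]haddC -haddA haddN hadd0r.
have pv2 : p' ∘ v ∘ two = two.
  by rewrite twor -twol ccompA b2 -ccompA tv ccomp1r.
(* From [2 = p' p = p' v 2 + p' s x = 2 + 2 x]. *)
have two_x : two ∘ x = '0.
  apply: (@hadd_cancel_l _ (tadd T) _ _ two).
  by rewrite hadd0r -{3}bp ex ccompDr !ccompA pv2 bs.
(* Now [s 2 = p 2 = v 4 + s (2 x) = 0]. *)
have s2 : s ∘ two = '0.
  have xc : s ∘ x ∘ two = s ∘ (two ∘ x) by rewrite twor twol ccompDr.
  rewrite -p2 ex ccompDl xc two_x hcomp0 -ccompA.
  have -> : two ∘ two = '0 by rewrite twol.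
  by rewrite hcomp0 hadd0.
(* As [h = 0], the map [fmap S s] has a left inverse, so [s 2 = 0] gives [2 = 0]. *)
have [|u eu] := @triangle_coexact _ _ _ _ _ _ _ (cid (S X))
  (triangle_rotate (triangle_rotate tri)).
  by rewrite en hcomp0.
apply: two0; apply: shift_faithful.
rewrite shift0 -[LHS]ccomp1l -eu hcompN hNcomp -ccompA -fmapM s2 shift0.
by rewrite hcomp0 hopp0.
Qed.

End Triangles.

(** * Doubling in the homotopy category *)

Section HomotopyCategory.
Variables (M : model_category) (hM : pointed M).
Variable HoM : triangulated_homotopy_category M.
Implicit Types A B D Q W Y E : M.

Local Notation hcolim := (@mc_colimits M).
Local Notation hT := (tc_axioms HoM).
Local Notation S := (tshift HoM).
Local Notation L := (ho_loc HoM).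
Local Notation "f ⊕ g" := (hadd (tadd HoM) f g) (at level 50, left associativity).
Local Notation "⊖ f" := (hopp (tadd HoM) f) (at level 35).
Local Notation "'0" := (hzero (tadd HoM) _ _) (at level 0).

Lemma loc_weq A B (f : hom A B) : weq f -> is_iso (fmap L f).
Proof. by have [h _ _] := ho_localization HoM; apply: h. Qed.

Lemma cone_exists A : inhabited (cone_on A).
Proof.
have [C [c [p [cc _ wp _]]]] := mc_factor_acyclic_fib (zero_map hM A (zero_ob hM)).
have [Q [q hq]] := coker_exists hM hcolim c.
constructor; apply: (@ConeOn M A C c Q q cc); last exact/(cofiberP hM).
move=> Z f hZ.
have e : f = zero_map hM (zero_ob hM) Z ∘ p.
  exact: to_zero_eq (terminal_is_zero hM hZ).
rewrite e; apply: weq_comp wp _; apply: weq_iso; exists (zero_map hM Z (zero_ob hM)).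
split; first exact: from_zero_eq (zero_obP hM).
exact: from_zero_eq (terminal_is_zero hM hZ).
Qed.

(** The connecting map passes through the mapping cone [P]: as [k], a pushout of [j], embeds the
    contractible cone by a cofibration, the collapse [u] is a weak equivalence and can be inverted
    in the homotopy category. *)
Lemma cofiber_texact A B D (j : hom A B) (p : hom B D) :
  cofibrant A -> cof j -> is_coker hM j p ->
  exists d, texact (fmap L j) (fmap L p) d.
Proof.
move=> hA cj hp; have [c] := cone_exists A.
have /(cofiberP hM) hc := cone_cofiber c.
have [P [k [l hP]]] := pushout_exists (cone_in c) j hcolim.
have [|u [uk ul]] := pushout_desc hP (a := zero_map hM _ _) (b := p).
  by rewrite hp.1 zero_comp.
have [|v [vk vl]] := pushout_desc hP (a := cone_proj c) (b := zero_map hM _ _).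
  by rewrite hc.1 zero_comp.
have ck : cof k := cof_pushout (pushoutC hP) cj.
have hC := cofibrant_cof hM hA (cone_in_cof c).
have wu : weq u.
  apply: (cone_quotient_weq hC (@cone_contractible _ _ c) ck).
  exact: coker_pushout (pushoutC hP) hp ul uk.
have [u' [u'u uu']] := loc_weq wu.
exists (susp_map (ho_suspension HoM) c hA ∘ fmap L v ∘ u'); apply/ho_exact.
exists A, B, D, j, p, hA, (susp_map (ho_suspension HoM) c hA ∘ fmap L v ∘ u').
split=> //; first exact/(cofiberP hM).
  exists c, P, k, l, u, v; split=> //.
  - by rewrite uk; split=> //; apply: zero_map_is_zero.
  - by rewrite vl; split=> //; apply: zero_map_is_zero.
  - by rewrite -ccompA u'u ccomp1r.
exists (cid _), (cid _), (cid _); split; first by split; apply: is_iso_id.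
by rewrite fmap1 !ccomp1l !ccomp1r.
Qed.

(** The identity of the zero object has zero cofiber, and a triangle whose first map is an identity
    has zero third object. *)
Lemma loc_zero_ob : is_zero (L (zero_ob hM)).
Proof.
have hz := zero_obP hM.
have hA : cofibrant (zero_ob hM).
  by apply/(cofibrantP hM) => X Y p _ _ b; exists (zero_map hM _ _); apply: from_zero_eq hz.
have cid_cof : cof (cid (zero_ob hM)) by have [h _ _] := mc_cof M.
have [d] := cofiber_texact hA cid_cof (is_coker_id hM _).
by rewrite fmap1 => /(triangle_cid_zero hT).
Qed.

Lemma loc_zero_map A B : fmap L (zero_map hM A B) = '0.
Proof.
rewrite -(comp_zero hM _ (zero_map hM (zero_ob hM) B)) fmapM.
by rewrite (from_zero (tadd HoM) (fmap L (zero_map hM _ B)) loc_zero_ob) h0comp.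
Qed.

Lemma loc_eq0_weq A B D (i : hom A B) (y : hom B D) :
  weq i -> y ∘ i = zero_map hM A D -> fmap L y = '0.
Proof.
move=> /loc_weq [i' [_ ii']] /(congr1 (fun u => fmap L u ∘ i')).
by rewrite fmapM -ccompA ii' ccomp1r loc_zero_map h0comp.
Qed.

(** Coproducts of cofibrant objects become biproducts: with [x] the sum of the images of [m ∘ p] and
    [n ∘ q], the difference [x - 1] vanishes on [m], so it factors through [q] by some [e], and
    restriction to [n] gives [e = 0]. *)
Lemma loc_coprod_sum A B D E Y (m : hom A D) (n : hom B D) (p : hom D A)
    (q : hom D B) (u : hom E D) (v : hom D Y) :
  is_coprod m n -> cofibrant A -> cofibrant B ->
  p ∘ m = cid A -> p ∘ n = zero_map hM _ _ ->
  q ∘ m = zero_map hM _ _ -> q ∘ n = cid B ->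
  fmap L (v ∘ u) = fmap L (v ∘ m) ∘ fmap L (p ∘ u) ⊕ fmap L (v ∘ n) ∘ fmap L (q ∘ u).
Proof.
move=> hD hA hB pm pn qm qn.
have [d tri] := cofiber_texact hA (coprod_cof_l hM hD hB) (coprod_coker hD qm qn).
pose x := fmap L (m ∘ p) ⊕ fmap L (n ∘ q).
suff x1 : x = cid (L D).
  rewrite fmapM -[fmap L u]ccomp1l -x1 /x ccompDl ccompDr -!fmapM.
  by rewrite !ccompA.
have xm : x ∘ fmap L m = fmap L m.
  by rewrite ccompDl -!fmapM -!ccompA pm qm comp_zero loc_zero_map hadd0r ccomp1r.
have xn : x ∘ fmap L n = fmap L n.
  by rewrite ccompDl -!fmapM -!ccompA pn qn comp_zero loc_zero_map hadd0 ccomp1r.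
clearbody x.
have [|e ee] := triangle_coexact hT (u := x ⊕ ⊖ cid _) tri.
  by rewrite ccompDl xm hNcomp ccomp1l haddNr.
have e0 : e = '0.
  rewrite -[LHS]ccomp1r -fmap1 -qn fmapM ccompA ee.
  by rewrite ccompDl xn hNcomp ccomp1l haddNr.
by apply: (hsub_eq0 (P := tadd HoM)); rewrite -ee e0 h0comp.
Qed.

Lemma coprod_sum A B : cofibrant A -> cofibrant B ->
  exists D (m : hom A D) (n : hom B D) (p : hom D A) (q : hom D B),
    [/\ is_coprod m n, p ∘ m = cid A /\ p ∘ n = zero_map hM _ _,
        q ∘ m = zero_map hM _ _ /\ q ∘ n = cid B
      & forall E Y (u : hom E D) (v : hom D Y),
          fmap L (v ∘ u) = fmap L (v ∘ m) ∘ fmap L (p ∘ u)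
                         ⊕ fmap L (v ∘ n) ∘ fmap L (q ∘ u)].
Proof.
move=> hA hB; have [D [m [n hD]]] := coprod_exists hM hcolim A B.
have [p [pm pn]] := coprod_desc hD (cid A) (zero_map hM _ _).
have [q [qm qn]] := coprod_desc hD (zero_map hM _ _) (cid B).
exists D, m, n, p, q; split=> // E Y u v.
exact: loc_coprod_sum.
Qed.

Section OneCylinder.
Variables (A Q : M) (i0 i1 : hom A Q) (r : hom Q A).
Hypothesis hQ : is_cylinder i0 i1 r.
Variables (Y W : M) (y : hom Q Y) (x1 x2 : hom Q W).
Hypotheses (hy : is_circle hM i0 i1 y) (hx : is_double hM i0 i1 x1 x2).
Variables (u1 u2 : hom W Y).
Hypotheses (u11 : u1 ∘ x1 = y) (u12 : u1 ∘ x2 = zero_map hM _ _).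
Hypotheses (u21 : u2 ∘ x1 = zero_map hM _ _) (u22 : u2 ∘ x2 = y).

Let hY : cofibrant Y := circle_cofibrant hQ hy.
Let hW : cofibrant W := (double_collapse hQ hy hx u11 u12).1.

(* On the theta graph, going along the third edge backwards and along either
   half of the first two forwards extends over the contractible [Q]. *)
Lemma collapses_eq : fmap L u1 = fmap L u2.
Proof.
have [y0 y1 _] := hy; have [xa xb xc _] := hx.
have [_ _ [w0 w1] [r0 r1]] := hQ.
have [_ [E [t1 [t2 [t3 ht]]]]] := double_theta_exist hM i0 i1.
have Ly : fmap L y = '0 by apply: loc_eq0_weq w0 y0.
(* [e] collapses the third edge, and [c] the other two. *)
have [|||e [e1 e2 e3]] := theta_desc ht (a := x1) (b := x2) (c := zero_map hM _ _).
1-3: by rewrite ?xa ?xb ?xc ?zero_comp.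
have [|||c [c1 c2 c3]] :=
  theta_desc ht (a := zero_map hM _ _) (b := zero_map hM _ _) (c := y).
1-3: by rewrite ?y0 ?y1 !zero_comp.
(* [a] and [b] retract the theta graph onto its third edge: they run through [Q] along the first,
   respectively the second, half and stay at an end of [Q] along the other. *)
have [|||a [a1 a2 a3]] := theta_desc ht (a := cid Q) (b := i1 ∘ r) (c := cid Q).
1-3: by rewrite -?ccompA ?r0 ?r1 ?ccomp1l ?ccomp1r.
have [|||b [b1 b2 b3]] := theta_desc ht (a := i0 ∘ r) (b := cid Q) (c := cid Q).
1-3: by rewrite -?ccompA ?r0 ?r1 ?ccomp1l ?ccomp1r.
have [D [m [n [p [q [hD [pm pn] [qm qn] sum]]]]]] := coprod_sum hW hY.
have [|||z [z1 z2 z3]] :=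
  theta_desc ht (a := m ∘ x1) (b := m ∘ x2) (c := n ∘ y).
- by rewrite -!ccompA xa y0 !comp_zero.
- by rewrite -!ccompA xb.
- by rewrite -!ccompA xc y1 !comp_zero.
have pz : p ∘ z = e.
  by apply: (theta_epi ht); rewrite -ccompA ?z1 ?z2 ?z3 ccompA ?pm ?pn
     ?ccomp1l ?zero_comp ?e1 ?e2 ?e3.
have qz : q ∘ z = c.
  by apply: (theta_epi ht); rewrite -ccompA ?z1 ?z2 ?z3 ccompA ?qm ?qn
     ?ccomp1l ?zero_comp ?c1 ?c2 ?c3.
(* [v1 ∘ z] and [v2 ∘ z] both factor through [y], which is zero in the homotopy category. Since [z]
   has components [e] and [c], comparing the two sums shows that [u1] and [u2] agree after
   composition with [e]. *)
have [v1 [v1m v1n]] := coprod_desc hD u1 (cid Y).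
have [v2 [v2m v2n]] := coprod_desc hD u2 (cid Y).
have v1z : v1 ∘ z = y ∘ a.
  apply: (theta_epi ht); rewrite -!ccompA ?z1 ?z2 ?z3 ?a1 ?a2 ?a3.
  - by rewrite ccompA v1m u11 ccomp1r.
  - by rewrite ccompA v1m u12 ccompA y1 zero_comp.
  - by rewrite ccompA v1n ccomp1l ccomp1r.
have v2z : v2 ∘ z = y ∘ b.
  apply: (theta_epi ht); rewrite -!ccompA ?z1 ?z2 ?z3 ?b1 ?b2 ?b3.
  - by rewrite ccompA v2m u21 ccompA y0 zero_comp.
  - by rewrite ccompA v2m u22 ccomp1r.
  - by rewrite ccompA v2n ccomp1l ccomp1r.
have := sum _ _ z v1; have := sum _ _ z v2.
rewrite v1z v2z pz qz v1m v2m v1n v2n !(fmapM _ y) Ly !h0comp => s2.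
rewrite {1}s2 => /hadd_cancel_r ue.
(* The third edge is split by [a], so the connecting map vanishes and [fmap L e] can be cancelled on
   the right. *)
have [d tri] := cofiber_texact (cylinder_cofibrant hM hQ) (theta_cof hM hQ ht)
  (theta_double_coker ht hx e1 e2 e3).
have d0 : d = '0.
  by apply: (triangle_split_mono hT (r := fmap L a) tri); rewrite -fmapM a3 fmap1.
apply: (hsub_eq0 (P := tadd HoM)).
have [|w <-] := triangle_coexact hT (u := fmap L u1 ⊕ ⊖ fmap L u2)
  (triangle_rotate hT tri).
  by rewrite ccompDl hNcomp ue haddNr.
by rewrite d0 hcomp0.
Qed.

(** [f] is the fold map after the pinch map [z] from [W] to the coproduct of two copies of [Y]; the
    components of [z] are the two collapses, which agree in the homotopy category by
    [collapses_eq]. *)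
Lemma double_loc (f : hom W Y) : f ∘ x1 = y -> f ∘ x2 = y ->
  fmap L f = fmap L u1 ⊕ fmap L u1.
Proof.
move=> f1 f2.
have [y0 y1 _] := hy.
have [D [m [n [p [q [hD [pm pn] [qm qn] sum]]]]]] := coprod_sum hY hY.
have [|||z [z1 z2]] := double_desc hx (a := m ∘ y) (b := n ∘ y).
1-3: by rewrite -!ccompA ?y0 ?y1 !comp_zero.
have [v [vm vn]] := coprod_desc hD (cid Y) (cid Y).
have -> : f = v ∘ z.
  by apply: (double_epi hx); rewrite -ccompA ?z1 ?z2 ccompA ?vm ?vn ccomp1l.
rewrite sum vm vn fmap1 !ccomp1l {2}collapses_eq.
have -> : p ∘ z = u1.
  by apply: (double_epi hx); rewrite -ccompA ?z1 ?z2 ccompA ?pm ?pn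
     ?ccomp1l ?zero_comp.
suff -> : q ∘ z = u2 by [].
by apply: (double_epi hx); rewrite -ccompA ?z1 ?z2 ccompA ?qm ?qn
   ?ccomp1l ?zero_comp.
Qed.

End OneCylinder.

Lemma collapses_exist A Q (i0 i1 : hom A Q) r : is_cylinder i0 i1 r ->
  exists Y (y : hom Q Y) W (x1 x2 : hom Q W) (u v : hom W Y),
    [/\ is_circle hM i0 i1 y, is_double hM i0 i1 x1 x2,
        u ∘ x1 = y /\ u ∘ x2 = zero_map hM _ _, v ∘ x1 = y /\ v ∘ x2 = y
      & is_iso (fmap L u) /\ fmap L v = fmap L u ⊕ fmap L u].
Proof.
move=> hQ; have [Y [y hy]] := circle_exists hM i0 i1.
have [y0 y1 _] := hy.
have [[W [x1 [x2 hx]]] _] := double_theta_exist hM i0 i1.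
have [|||u [u1 u2]] := double_desc hx (a := y) (b := zero_map hM _ _).
1-3: by rewrite ?y0 ?y1 ?zero_comp.
have [|||u' [u1' u2']] := double_desc hx (a := zero_map hM _ _) (b := y).
1-3: by rewrite ?y0 ?y1 ?zero_comp.
have [|||v [v1 v2]] := double_desc hx (a := y) (b := y).
1-3: by rewrite ?y0 ?y1.
exists Y, y, W, x1, x2, u, v; split=> //; split.
  by apply: loc_weq; case: (double_collapse hQ hy hx u1 u2).
exact: (double_loc hQ hy hx u1 u2 u1' u2' v1 v2).
Qed.

(** Dividing the cylinders by their second ends gives cones in the sense of [cone_on] whose
    quotients are the circles; naturality of the suspension applies to the map of cones induced by
    [q]. *)
Lemma circle_suspension A B Q Q' (j : hom A B) (q : hom Q Q') (i0 i1 : hom A Q) r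
    (i0' i1' : hom B Q') r' Y Y' (y : hom Q Y) (y' : hom Q' Y') (f : hom Y Y') :
  is_cylinder i0 i1 r -> is_cylinder i0' i1' r' ->
  i0' ∘ j = q ∘ i0 -> i1' ∘ j = q ∘ i1 ->
  is_circle hM i0 i1 y -> is_circle hM i0' i1' y' -> f ∘ y = y' ∘ q ->
  exists (a : hom (L Y) (S (L A))) (b : hom (L Y') (S (L B))),
    [/\ is_iso a, is_iso b & b ∘ fmap L f = fmap S (fmap L j) ∘ a].
Proof.
move=> hQ hQ' q0 q1 hy hy' ef.
have [y0 y1 _] := hy; have [y0' y1' _] := hy'.
have [hA _ _ _] := hQ; have [hB _ _ _] := hQ'.
have [C [k hk]] := coker_exists hM hcolim i1.
have [C' [k' hk']] := coker_exists hM hcolim i1'.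
have [z ez] := coker_desc hk y1; have [z' ez'] := coker_desc hk' y1'.
have /(cofiberP hM) cz := cylinder_cone_circle hk hy ez.
have /(cofiberP hM) cz' := cylinder_cone_circle hk' hy' ez'.
pose c := ConeOn (cylinder_cone_cof hQ hk) (cylinder_cone_contractible hQ hk) cz.
pose c' := ConeOn (cylinder_cone_cof hQ' hk') (cylinder_cone_contractible hQ' hk') cz'.
have [|b eb] := coker_desc hk (a := k' ∘ q).
  by rewrite -ccompA -q1 ccompA hk'.1 zero_comp.
exists (susp_map (ho_suspension HoM) c hA), (susp_map (ho_suspension HoM) c' hB).
split.
- exact (susp_iso (ho_suspension HoM) c hA).
- exact (susp_iso (ho_suspension HoM) c' hB).
- have e1 : b ∘ cone_in c = cone_in c' ∘ j by rewrite /= ccompA eb -!ccompA q0.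
  have e2 : f ∘ cone_proj c = cone_proj c' ∘ b.
    by apply: (coker_epi hk); rewrite /= -!ccompA ez eb ccompA ez'.
  exact (@susp_natural _ _ _ _ (ho_suspension HoM) A B c c' hA hB j b f e1 e2).
Qed.

(* Writing [2] for twice the identity, [(2, 2, 2)] on a cofiber sequence
   [X -> Y -> C] factors through [(2, p, 1)] and [(1, b, 2)], with middle
   sequence [X -> P -> C]. *)
Lemma double_factors A B (j : hom A B) : cofibrant A -> cof j ->
  exists (X Y C P : HoM) (f : hom X Y) (g : hom Y C) (h : hom C (S X))
         (s : hom X P) (t : hom P C) (d : hom C (S X)) (p : hom Y P) (b : hom P Y)
         (x : hom X (S (L A))) (y : hom Y (S (L B))),
  [/\ texact f g h, texact s t d,
      [/\ is_iso x, is_iso y & y ∘ f = fmap S (fmap L j) ∘ x],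
      p ∘ f = s ⊕ s /\ t ∘ p = g
    & [/\ b ∘ s = f, g ∘ b = t ⊕ t & b ∘ p = cid Y ⊕ cid Y]].
Proof.
move=> hA cj.
have [QA [i0 [i1 [rA hQA]]]] := cylinder_exists hM hA.
have [QB [i0' [i1' [rB [q [hQB rel [q0 q1] rq]]]]]] := cylinder_relative hM cj hQA.
have [D [g hg]] := coker_exists hM hcolim j.
have [QD [k hk]] := coker_exists hM hcolim q.
have [|d0 k0] := coker_desc hg (a := k ∘ i0').
  by rewrite -ccompA q0 ccompA hk.1 zero_comp.
have [|d1 k1] := coker_desc hg (a := k ∘ i1').
  by rewrite -ccompA q1 ccompA hk.1 zero_comp.
have [rD hQD] := cylinder_quotient cj hg hQA hQB rel q0 q1 rq hk k0 k1.
have [YA [yA [WA [a1 [a2 [uA [vA [hyA hxA [uA1 uA2] [vA1 vA2]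
  [[uA' [uAl uAr]] LvA]]]]]]]]] := collapses_exist hQA.
have [YB [yB [WB [b1 [b2 [uB [vB [hyB hxB [uB1 uB2] [vB1 vB2]
  [[uB' [uBl uBr]] LvB]]]]]]]]] := collapses_exist hQB.
have [YD [yD [WD [c1 [c2 [uD [vD [hyD hxD [uD1 uD2] [vD1 vD2]
  [[uD' [uDl uDr]] LvD]]]]]]]]] := collapses_exist hQD.
have [yA0 yA1 _] := hyA; have [yB0 yB1 _] := hyB; have [yD0 yD1 _] := hyD.
have [bx0 bx bx1 _] := hxB; have [cx0 cx cx1 _] := hxD.
have [||f ef] := circle_desc hyA (a := yB ∘ q).
- by rewrite -ccompA -q0 ccompA yB0 zero_comp.
- by rewrite -ccompA -q1 ccompA yB1 zero_comp.
have [||h eh] := circle_desc hyB (a := yD ∘ k).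
- by rewrite -ccompA -k0 ccompA yD0 zero_comp.
- by rewrite -ccompA -k1 ccompA yD1 zero_comp.
have [|||F [F1 F2]] := double_desc hxA (a := b1 ∘ q) (b := b2 ∘ q).
- by rewrite -ccompA -q0 ccompA bx0 zero_comp.
- by rewrite -!ccompA -q0 -q1 !ccompA bx.
- by rewrite -ccompA -q1 ccompA bx1 zero_comp.
have [|||G [G1 G2]] := double_desc hxB (a := c1 ∘ k) (b := c2 ∘ k).
- by rewrite -ccompA -k0 ccompA cx0 zero_comp.
- by rewrite -!ccompA -k0 -k1 !ccompA cx.
- by rewrite -ccompA -k1 ccompA cx1 zero_comp.
(* The circles and the doubles each form a cofiber sequence; the collapses [uA], [uB], [uD] and the
   doublings [vA], [vB], [vD] are strict maps from the second to the first. *)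
have [cf hfh] := circle_relative hg hk rel k0 k1 hyA hyB hyD ef eh.
have [cF hFG] := double_relative cj hg hk rel q1 k0 k1 hxA hxB hxD F1 F2 G1 G2.
have fu : f ∘ uA = uB ∘ F.
  by apply: (double_epi hxA); rewrite -!ccompA ?F1 ?F2 ?uA1 ?uA2 ccompA ?uB1 ?uB2
     ?comp_zero ?zero_comp.
have fv : f ∘ vA = vB ∘ F.
  by apply: (double_epi hxA); rewrite -!ccompA ?F1 ?F2 ?vA1 ?vA2 ccompA ?vB1 ?vB2.
have hu : h ∘ uB = uD ∘ G.
  by apply: (double_epi hxB); rewrite -!ccompA ?G1 ?G2 ?uB1 ?uB2 ccompA ?uD1 ?uD2
     ?comp_zero ?zero_comp.
have hv : h ∘ vB = vD ∘ G.
  by apply: (double_epi hxB); rewrite -!ccompA ?G1 ?G2 ?vB1 ?vB2 ccompA ?vD1 ?vD2.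
(* Pushing the sequence of doubles out along [vA] gives [YA -> P -> WD], through which the strict
   doubling map factors. *)
have [P [i [s hP]]] := pushout_exists F vA hcolim.
have [Pe _] := hP.
have [|t [ti ts]] := pushout_desc hP (a := G) (b := zero_map hM _ _).
  by rewrite hFG.1 zero_comp.
have [|b [bi bs]] := pushout_desc hP (a := vB) (b := f); first by rewrite fv.
have hb : h ∘ b = vD ∘ t.
  by apply: (pushout_epi hP); rewrite -!ccompA ?bi ?bs ?ti ?ts ?hv // comp_zero hfh.1.
have hYA := circle_cofibrant hQA hyA.
have [e1 tri1] := cofiber_texact hYA cf hfh.
have [e2 tri2] := cofiber_texact hYA (cof_pushout hP cF) (coker_pushout hP hFG ti ts).
have [x [y [hx hy exy]]] := circle_suspension hQA hQB q0 q1 hyA hyB ef.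
(* In the homotopy category the collapses identify each double with its circle, and under this
   identification the doublings become twice the identity. *)
exists (L YA), (L YB), (L YD), (L P), (fmap L f), (fmap L h), e1, (fmap L s),
  (fmap L uD ∘ fmap L t), (e2 ∘ uD'), (fmap L i ∘ uB'), (fmap L b), x, y.
split=> //.
- apply: (tr_iso hT) tri2; exists (cid _), (cid _), (fmap L uD).
  split; first by split; try exact: is_iso_id; exists uD'.
  by rewrite fmap1 !ccomp1r !ccomp1l -ccompA uDl ccomp1r.
- have Lf : uB' ∘ fmap L f = fmap L F ∘ uA'.
    rewrite -[LHS]ccomp1r -uAr ccompA -(ccompA uB') -fmapM fu fmapM ccompA uBl.
    by rewrite ccomp1l.
  split.
    rewrite -ccompA Lf ccompA -fmapM Pe fmapM LvA ccompDr ccompDl.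
    by rewrite -!ccompA uAr ccomp1r.
  rewrite ccompA -(ccompA (fmap L uD)) -fmapM ti -fmapM -hu fmapM -ccompA uBr.
  by rewrite ccomp1r.
- split; first by rewrite -fmapM bs.
    by rewrite -fmapM hb fmapM LvD ccompDl.
  by rewrite ccompA -fmapM bi LvB ccompDl uBr.
Qed.

End HomotopyCategory.

(** * Modules over Z/4 *)

Section LinearMaps.
Local Open Scope ring_scope.
Import GRing.Theory.
Variables (R : nzRingType) (P : lmodType R).

Definition scale_at (x : P) (a : R^o) : P := a *: x.

Lemma scale_at_linear x : linear (scale_at x).
Proof. by move=> c a b; rewrite /scale_at scalerDl scalerA. Qed.

HB.instance Definition _ x :=
  GRing.isLinear.Build R R^o P _ (scale_at x) (scale_at_linear x).

Definition lin_comb n (e : 'I_n -> P) (v : 'rV[R]_n) : P :=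
  \sum_(i < n) v 0 i *: e i.

Lemma lin_comb_linear n (e : 'I_n -> P) : linear (lin_comb e).
Proof.
move=> c u v; rewrite /lin_comb scaler_sumr -big_split; apply: eq_bigr => i _.
by rewrite !mxE scalerDl scalerA.
Qed.

HB.instance Definition _ n (e : 'I_n -> P) :=
  GRing.isLinear.Build R 'rV[R]_n P _ (lin_comb e) (lin_comb_linear e).

End LinearMaps.

Section RegularModule.
Local Open Scope ring_scope.
Import GRing.Theory.
Variable R : nzRingType.

Lemma regular_finitely_generated : finitely_generated (R^o : lmodType R).
Proof.
exists 1%N, (fun=> 1) => x; exists (fun=> x).
by rewrite big_ord1 /GRing.scale /= mulr1.
Qed.

Lemma regular_projective : projective (R^o : lmodType R).
Proof.
move=> M N g f surj; have [x ex] := surj (f 1).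
exists (scale_at x : {linear R^o -> M}) => a /=.
by rewrite /scale_at linearZ /= ex -linearZ /= /GRing.scale /= mulr1.
Qed.

Definition regular : fgproj R := FgProj regular_finitely_generated regular_projective.

Lemma linear_regular_ext (M : lmodType R) (f g : {linear R^o -> M}) :
  f 1 = g 1 -> f = g.
Proof.
move=> e; apply: linear_ext => a.
by rewrite -[a]mulr1 -[a * 1]/(a *: (1 : R^o)) !linearZ /= e.
Qed.

End RegularModule.

Section ModuloFour.
Local Open Scope ring_scope.
Import GRing.Theory.
Local Notation R := 'Z_4.

Lemma Z4_cases (a : R) : a = 0 \/ a = 1 \/ a = 1 + 1 \/ a = - 1.
Proof.
case: a => [[|[|[|[|//]]]] lt];
  [left | right; left | right; right; left | right; right; right];
  exact: val_inj.
Qed.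

Lemma Z4_halve (a : R) : a + a = 0 -> exists b, a = b + b.
Proof.
have [->|[->|[->|->]]] := Z4_cases a.
- by exists 0; rewrite addr0.
- by move/(congr1 val).
- by exists 1.
- by move/(congr1 val).
Qed.

Lemma Z4_four (M : lmodType R) (x : M) : x + x + (x + x) = 0.
Proof.
rewrite -[x]scale1r -!scalerDl.
suff -> : (1 + 1 + (1 + 1) : R) = 0 by rewrite scale0r.
exact: val_inj.
Qed.

(** The projection of a free module onto [P] has a section [h], and coordinates in ['Z_4] that are
    killed by two can be halved. *)
Lemma Z4_projective_halve (P : fgproj R) (x : P) :
  x + x = 0 -> exists y, x = y + y.
Proof.
move=> x2; have [n [e he]] := fgproj_fg P.
have [|h hK] := @fgproj_projective _ P _ _ (lin_comb e : {linear 'rV[R]_n -> P})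
    (idfun : {linear P -> P}).
  move=> y; have [a ->] := he y; exists (\row_i a i).
  by apply: eq_bigr => i _; rewrite mxE.
have hx2 i : h x 0 i + h x 0 i = 0.
  by have := congr1 (fun v : 'rV[R]_n => v 0 i) (linearD h x x);
     rewrite x2 linear0 !mxE => <-.
have /choice [b hb] i := Z4_halve (hx2 i).
exists (lin_comb e (\row_i b i)); rewrite -linearD -[LHS]hK /=.
by congr lin_comb; apply/rowP => i; rewrite !mxE hb.
Qed.

Variables (E : triangle_class (functor_id (proj_cat R))).
Hypothesis hE : is_triangulated (proj_triangles E).

Definition regular_two : @hom (proj_cat R) (regular R) (regular R) :=
  hadd (proj_add R) (cid (regular R : proj_cat R)) (cid (regular R : proj_cat R)).

Lemma regular_endo (e : @hom (proj_cat R) (regular R) (regular R)) :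
  [\/ e = hzero (proj_add R) _ _, e = cid _, e = regular_two
    | e = hopp (proj_add R) (cid _)].
Proof.
have [h|[h|[h|h]]] := Z4_cases (e 1);
  [apply: Or41|apply: Or42|apply: Or43|apply: Or44];
  exact: linear_regular_ext.
Qed.

Lemma regular_two_neq0 : regular_two <> hzero (proj_add R) _ _.
Proof.
move/(congr1 (fun f : {linear R^o -> R^o} => f 1)).
by move/(congr1 (fun a : R => val a)).
Qed.

Lemma regular_four : hadd (proj_add R) regular_two regular_two = hzero (proj_add R) _ _.
Proof. by apply: linear_regular_ext; apply: val_inj. Qed.

(** The cone [C] of two is projective, so [g 1], which is killed by two, is twice some [c0]. The map
    [g'] sending [1] to [c0] is an isomorphism under which the triangle becomes [(2, 2, 2)]. *)
Lemma regular_triangle :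
  @texact (proj_triangles E) (regular R) (regular R) (regular R)
    regular_two regular_two regular_two.
Proof.
have [C [g [h tri]]] := tr_cone hE regular_two.
have g2 : g 1 + g 1 = 0.
  have := congr1 (fun f : {linear R^o -> C} => f 1) (triangle_comp hE tri).
  by move=> /= <-; rewrite -linearD.
have [c0 ec0] := Z4_projective_halve g2.
pose g' : @hom (proj_cat R) (regular R) C := scale_at c0.
have eg : g = g' ∘ regular_two.
  by apply: linear_regular_ext; rewrite ec0 /= /scale_at scalerDl scale1r.
(* If [g] vanished, the identity would factor through two. *)
have c1 : c0 + c0 <> 0.
  move=> c1; have [|v ev] := triangle_exact hE (u := cid _) tri.
    by apply: linear_regular_ext; rewrite /= ec0.
  have := congr1 (fun f : {linear R^o -> R^o} => f 1) ev => /=.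
  by have [->|[->|[->|->]]] := Z4_cases (v 1) => /(congr1 (fun a : R => val a)).
have lift c : h c = 0 -> exists v, c = g v.
  move=> hc; pose u : @hom (proj_cat R) (regular R) C := scale_at c.
  have [|v ev] := triangle_exact hE (u := u) (triangle_rotate hE tri).
    by apply: linear_regular_ext; rewrite /= /scale_at scale1r.
  exists (v 1); have := congr1 (fun f : {linear R^o -> C} => f 1) ev.
  by rewrite /= /scale_at scale1r.
have h2 c : h c + h c = 0.
  have := triangle_comp hE (triangle_rotate hE (triangle_rotate hE tri)).
  move/(congr1 (fun f : {linear C -> R^o} => f c)) => /= e.
  by rewrite -[LHS]opprK e oppr0.
have h02 c : h c = 0 \/ h c = 1 + 1.
  have := h2 c; have [->|[->|[->|->]]] := Z4_cases (h c); by [left|right].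
(* If [h c0] were zero, then [c0 = v (2 c0)] for some [v], so [2 c0 = v (4 c0) = 0]. *)
have hc0 : h c0 = 1 + 1.
  have [/lift [v ev]|//] := h02 c0; case: c1.
  have gv : g v = v *: (c0 + c0).
    by rewrite -ec0 -linearZ /=; congr (g _); rewrite /GRing.scale /= mulr1.
  by rewrite ev gv -scalerDr Z4_four scaler0.
have g'1 : g' 1 = c0 by rewrite /= /scale_at scale1r.
(* An element with [h c = 2] differs from [c0] by an element of the kernel of [h], which is the
   image of [g]. *)
have surj c : exists x, g' x = c.
  have gx x : g x = g' (x + x) by rewrite eg.
  have [/lift [v ->]|hc] := h02 c; first by exists (v + v); rewrite gx.
  have [|v ev] := lift (c - c0); first by rewrite linearB /= hc hc0 subrr.
  exists (v + v + 1); rewrite linearD -gx -ev.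
  by rewrite g'1 subrK.
have inj a b : g' a = g' b -> a = b.
  move=> /eqP; rewrite -subr_eq0 -linearB /= /scale_at => /eqP e.
  apply/eqP; rewrite -subr_eq0; apply/eqP; move: e.
  have [->|[->|[->|->]]] := Z4_cases (a - b) => // /eqP.
  - by rewrite scale1r => /eqP e; case: c1; rewrite e addr0.
  - by rewrite scalerDl scale1r => /eqP.
  - by rewrite scaleN1r oppr_eq0 => /eqP e; case: c1; rewrite e addr0.
(* Projectivity of [C] splits the bijection [g'], which provides its inverse as a linear map. *)
have [k gk] := @fgproj_projective _ C _ _ (g' : {linear R^o -> C}) (idfun : {linear C -> C}) surj.
have gk' : g' ∘ (k : @hom (proj_cat R) C (regular R)) = cid _ by apply: linear_ext.
have kg : (k : @hom (proj_cat R) C (regular R)) ∘ g' = cid _.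
  by apply: linear_ext => a; apply: inj; rewrite /= gk.
have hg : h ∘ g' = regular_two.
  by apply: linear_regular_ext; rewrite [LHS]/= /scale_at scale1r hc0.
apply: (tr_iso hE) tri; exists (cid _), (cid _), k.
split; first by split; try exact: is_iso_id; exists g'.
split; first by rewrite ccomp1l ccomp1r.
  by rewrite ccomp1r eg ccompA kg ccomp1l.
by rewrite fmap1 ccomp1l -hg -ccompA gk' ccomp1r.
Qed.

End ModuloFour.

(** * Transport of the triangle to the homotopy category, and the contradiction *)

Theorem theorem1p3 (M : model_category) (hM : stable M)
    (HoM : triangulated_homotopy_category M)
    (E : triangle_class (functor_id (proj_cat 'Z_4)))
    (hE : is_triangulated (proj_triangles E))
    (P : full_triangulated_subcategory HoM) :
  ~ exact_equivalent (proj_triangles E) (sub_data P).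
Proof.
case=> F [[addF [tau [tauI tauE]]] eqF].
have hT := tc_axioms HoM.
pose R0 : proj_triangles E := regular 'Z_4.
pose X : HoM := sval (F R0).
pose two : hom X X := hadd (tadd HoM) (cid X) (cid X).
have F2 : fmap F (regular_two : @hom (proj_triangles E) R0 R0) = two.
  by rewrite /regular_two addF fmap1.
have F0 : fmap F (hzero (tadd (proj_triangles E)) R0 R0) = hzero (tadd HoM) X X.
  exact: (additive_functor0 _ _ addF).
(* The translation of the source is the identity, so [tau R0] goes from [X] to its own
   suspension. *)
pose w : hom X (tshift HoM X) := tau R0.
have wI : is_iso w.
  by have [w' [w1 w2]] := tauI R0; exists w'.
have tri : texact two two (w ∘ two).
  by have := tauE _ _ _ _ _ _ (regular_triangle hE); rewrite F2.
have two0 : two <> hzero (tadd HoM) X X.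
  rewrite -F2 -F0 => /(equivalence_faithful eqF); exact: regular_two_neq0.
have four0 : hadd (tadd HoM) two two = hzero (tadd HoM) X X.
  by rewrite -F2 -F0 -(regular_four); symmetry; apply: addF.
have hend (e : hom X X) : e = hzero (tadd HoM) X X \/ e = cid X \/ e = two \/
    e = hopp (tadd HoM) (cid X).
  have [e0 <-] := @equivalence_full _ _ F R0 R0 e eqF.
  have [->|->|->|->] := regular_endo e0.
  - by left.
  - by right; left; exact (fmap1 F R0).
  - by right; right; left.
  - right; right; right.
    by rewrite -(fmap1 F R0 : _ = cid X); exact: (additive_functorN _ addF).
(* Exact triangles are isomorphic to cofiber sequences, so twice the identity of [X] is isomorphic
   to the image of a cofibration [j] with cofibrant source. *)
have [A [B [D [j [p [hA [d [cj _ _ [a [b [_ [[aI bI _] [ab _ _]]]]]]]]]]]]] :=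
  (ho_exact two two (w ∘ two)).1 tri.
have [X' [Y' [C' [P' [f [g [h [s [t [e [q [r [x [y [tri1 tri2 [xI yI xy]
  [qf tq] [rs gr rq]]]]]]]]]]]]]]]] := double_factors hM.1 HoM hA cj.
have [w' [w'w ww']] := wI.
have w'I : is_iso w' by exists w.
have two_nat Y (u : hom Y X) : two ∘ u = hadd (tadd HoM) u u.
  by rewrite ccompDl ccomp1l.
have nat_two Y (u : hom X Y) : u ∘ two = hadd (tadd HoM) u u.
  by rewrite ccompDr ccomp1r.
(* The triangle from [double_factors] begins with the suspension of the image of [j]; [a], [b] and
   [w'] identify its first two objects with [X]. *)
pose α := w' ∘ fmap (tshift HoM) a ∘ x.
pose β := w' ∘ fmap (tshift HoM) b ∘ y.
have αI : is_iso α by do !apply: is_iso_comp => //; apply: is_iso_fmap.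
have βI : is_iso β by do !apply: is_iso_comp => //; apply: is_iso_fmap.
have αβ : two ∘ α = β ∘ f.
  rewrite /β -ccompA xy ccompA -(ccompA w') -fmapM -ab two_nat -two_nat.
  rewrite fmapM (tr_shift_additive hT) fmap1 /α !ccompA; congr (_ ∘ _ ∘ _).
  by rewrite ccompDl ccompDr ccomp1l ccomp1r.
clearbody α β.
(* The third objects are then isomorphic as well, so the whole factorization can be conjugated to
   the triangle on [X]. *)
have [γ [γI βγ _]] := triangle_iso_third hT tri1 tri αI βI αβ.
have [α' [α'α αα']] := αI; have [β' [β'β ββ']] := βI; have [γ' [γ'γ γγ']] := γI.
have β'2 : β' ∘ two = f ∘ α'.
  by rewrite -[LHS]ccomp1r -αα' ccompA -(ccompA β') αβ !ccompA β'β ccomp1l.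
apply: (@no_double_of_two HoM hT X w P' (s ∘ α') (γ ∘ t) (β ∘ r) (q ∘ β')
  (fmap (tshift HoM) α ∘ e ∘ γ')) => //.
- apply: (tr_iso hT) tri2; exists α, (cid _), γ; split.
    by split=> //; apply: is_iso_id.
  by rewrite -!ccompA α'α γ'γ !ccomp1r ccomp1l.
- by rewrite -ccompA β'2 ccompA qf nat_two ccompDl.
- by rewrite -ccompA (ccompA t) tq ccompA -βγ -ccompA ββ' ccomp1r.
- by rewrite -ccompA (ccompA r) rs ccompA -αβ -ccompA αα' ccomp1r.
- by rewrite ccompA βγ -ccompA gr ccompDr two_nat.
- by rewrite -ccompA (ccompA r) rq ccompDl ccomp1l ccompDr ββ'.
Qed.
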